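(* Let $\gamma\subset\mathbb{R}^2$ be a smooth, strictly convex, closed curve whose curvature vanishes at some point. Then the symplectic billiard in $\gamma$ has no caustics.
   Context: Let $\omega$ be the standard area form on $\mathbb{R}^2$, and let $\gamma$ be a smooth, strictly convex, closed, positively oriented curve with outer normal $\nu_x$ at $x\in\gamma$. The phase space is $\mathcal{P}=\{(x,y)\in\gamma\times\gamma : \omega(\nu_x,\nu_y)>0\}$, an open annulus. The symplectic billiard map is $\Phi:\mathcal{P}\to\mathcal{P}$, $\Phi(x,y)=(y,z)$, where $z\in\gamma$ is the unique point different from $x$ such that $z-x$ is parallel to $T_y\gamma$. A caustic is the envelope of the lines containing the chords $xy$ of a 1-parameter family given by the points $(x,y)$ of an invariant curve of $\Phi$, that is, a $\Phi$-invariant, homotopically non-trivial, simple closed curve in $\mathcal{P}$. Thus ''$\gamma$ has no caustics'' means that $\Phi$ has no such invariant curve in $\mathcal{P}$. *)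

(* Defs.v *)
From HB Require Import structures.
From mathcomp Require Import all_boot all_order all_algebra.
From mathcomp Require Import all_classical all_reals all_analysis.

Set Implicit Arguments.
Unset Strict Implicit.
Unset Printing Implicit Defensive.

Import Order.TTheory GRing.Theory Num.Theory.
Import numFieldNormedType.Exports.

Local Open Scope ring_scope.
Local Open Scope classical_set_scope.

Notation plane R := (R * R)%type (only parsing).

Section SymplecticBilliard.
Variable R : realType.
Implicit Types (u v : plane R) (g : R -> plane R).

Definition area_form u v : R := u.1 * v.2 - u.2 * v.1.

(* The library's norm on R * R is the sup norm. *)
Definition euclidean_norm v : R := Num.sqrt (v.1 ^+ 2 + v.2 ^+ 2).

(* A closed curve is given by a 1-periodic parametrization, i.e. by a smooth
   embedding of the circle R / Z. *)
Definition smooth_closed_curve g :=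
  [/\ forall (n : nat) (t : R), derivable (g^`(n)) t 1,
      forall t, g^`() t != 0 &
      forall s t, g s = g t <-> exists k : int, s = t + k%:~R].

Definition strictly_convex g := forall t,
  (forall s, g s <> g t -> 0 < area_form (g^`() t) (g s - g t)) \/
  (forall s, g s <> g t -> area_form (g^`() t) (g s - g t) < 0).

(* Orientation of a convex curve: every oriented tangent line has the curve on
   its left. *)
Definition positively_oriented g :=
  forall s t, 0 <= area_form (g^`() t) (g s - g t).

Definition curvature g t : R :=
  area_form (g^`() t) (g^`(2) t) / euclidean_norm (g^`() t) ^+ 3.

(* The outer normal of a positively oriented curve is its unit tangent rotated
   by a right angle clockwise. *)
Definition outer_normal g t : plane R :=
  (euclidean_norm (g^`() t))^-1 *: ((g^`() t).2, - (g^`() t).1).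

Definition phase_space g : set (plane R * plane R) :=
  [set p | exists s t,
    p = (g s, g t) /\ 0 < area_form (outer_normal g s) (outer_normal g t)].

Definition parallel_to_tangent g y v :=
  exists2 t, g t = y & area_form (g^`() t) v = 0.

(* For (x, y) in the phase space of a smooth strictly convex closed curve
   exactly one z satisfies the predicate; the value x is used when there is
   none. *)
Definition symplectic_billiard g (p : plane R * plane R) : plane R * plane R :=
  (p.2, xget p.1 [set z | [/\ range g z, z <> p.1 &
                              parallel_to_tangent g p.2 (z - p.1)]]).

Definition simple_loop (T : topologicalType) (P : set T) (c : R -> T) :=
  [/\ {within `[0, 1], continuous c},
      forall t : R, `[0, 1] t -> P (c t),
      c 0 = c 1 &
      forall s t : R, `[0, 1[ s -> `[0, 1[ t -> c s = c t -> s = t].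

(* Free homotopy of loops inside P, H (s, _) being the loop at time s. *)
Definition null_homotopic (T : topologicalType) (P : set T) (c : R -> T) :=
  exists2 H : R * R -> T, {within `[0, 1] `*` `[0, 1], continuous H} &
    [/\ forall s t : R, `[0, 1] s -> `[0, 1] t -> P (H (s, t)),
        forall s : R, `[0, 1] s -> H (s, 0) = H (s, 1),
        forall t : R, `[0, 1] t -> H (0, t) = c t &
        exists p, forall t : R, `[0, 1] t -> H (1, t) = p].

Definition invariant_curve g (c : R -> plane R * plane R) :=
  [/\ simple_loop (phase_space g) c,
      ~ null_homotopic (phase_space g) c &
      symplectic_billiard g @` (c @` `[0, 1]) = c @` `[0, 1]].

(* Caustics are the envelopes of the chord families of the invariant curves, so
   the existence of a caustic is the existence of an invariant curve. *)
Definition has_caustic g := exists c, invariant_curve g c.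

End SymplecticBilliard.

(* Main.v *)
Require Import Defs.
From mathcomp Require Import all_boot all_order all_algebra.
From mathcomp Require Import all_classical all_reals all_analysis.
From mathcomp Require Import measurable_realfun.
From mathcomp Require Import ring lra zify.

(* An invariant curve is lifted to x |-> (a x, a (phi x)), where a is a lift of the
   first component of nonzero degree and phi an increasing lift of the dynamics.
   The running maximum M of a is a subsolution of the orbit equation because of the
   twist condition. Integrating the resulting nonnegative function against
   d(M o phi) over a period gives zero, because the integrand is the differential
   of a periodic function, so the inequality is an equality wherever M grows. At
   the end of a plateau of M this would give two points of the curve with the same
   coordinates, so M has no plateau and a = M is increasing: this is Birkhoff's
   graph theorem. Along a monotone invariant curve the chord from the previous
   point to the next one is parallel to the tangent, and both endpoints move
   forward; at a point of zero curvature the tangent does not turn to first order,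
   so the next point moves infinitely slowly, which contradicts the same relation
   one step later. *)

Set Implicit Arguments.
Unset Strict Implicit.
Unset Printing Implicit Defensive.

Import Order.TTheory GRing.Theory Num.Theory.
Import numFieldNormedType.Exports.

Local Open Scope ring_scope.
Local Open Scope classical_set_scope.

(** * Real analysis *)

(** The obstacle is regularity. An invariant curve is only continuous, so [a] may a priori go back
    and forth, and neither [M] nor [phi] is differentiable. Passing to [M] restores monotonicity,
    hence a Stieltjes integral, at the price of an inequality. The chain rule is replaced by
    estimates on increments whose error is quadratic in the increment of one continuous monotone
    function; such errors vanish under subdivision. The integrand is exact because the map has the
    generating function omega(g s, g t): its partial derivatives at two consecutive pairs add up to
    the orbit equation, and the leftover terms form a difference between a primitive and its
    composition with [phi], which is periodic. The nonzero degree is where homotopic non-triviality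
    enters: a curve of degree zero can be contracted inside the phase space by shortening and then
    sliding its chords. *)

Section Calculus.
Variable R : realType.
Implicit Types (f df : R -> R) (x y a b : R).

Lemma continuous_distP (E : normedModType R) (f : R -> E) x :
  {for x, continuous f} <->
  forall e, 0 < e -> exists2 d, 0 < d & forall y, `|y - x| < d -> `|f y - f x| < e.
Proof.
split=> [fc e e0|H].
  have /cvgrPdist_lt /(_ e e0) := fc => /nbhs_ballP[d /= d0 dH].
  exists d => // y yx; rewrite distrC; apply: dH.
  by rewrite /ball /= distrC.
apply/cvgrPdist_lt => e e0; have [d d0 dH] := H e e0.
apply/nbhs_ballP; exists d => //= y; rewrite /ball /= => yx.
by rewrite distrC; apply: dH; rewrite distrC.
Qed.

Lemma ivt f a b v : continuous f -> a <= b -> f a <= v <= f b ->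
  exists2 c, a <= c <= b & f c = v.
Proof.
move=> fc ab /andP[av vb].
have [||c cab <-] := @IVT R f a b v ab; last by exists c.
  exact: continuous_subspaceT.
by rewrite ge_min av /= le_max vb orbT.
Qed.

Lemma ivt_dec f a b v : continuous f -> a <= b -> f b <= v <= f a ->
  exists2 c, a <= c <= b & f c = v.
Proof.
move=> fc ab /andP[av vb].
have [||c cab <-] := @IVT R f a b v ab; last by exists c.
  exact: continuous_subspaceT.
by rewrite ge_min av orbT /= le_max vb.
Qed.

Lemma derive_cont (V : normedModType R) (f : R -> V) (df : V) x :
  is_derive x 1 f df -> {for x, continuous f}.
Proof.
move=> d; apply: differentiable_continuous; apply/derivable1_diffP.
exact: (@ex_derive _ _ _ _ _ _ _ d).
Qed.

Lemma mvt f df a b : (forall x, is_derive x 1 f (df x)) -> a < b ->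
  exists2 c, a < c < b & f b - f a = df c * (b - a).
Proof.
move=> fd ab.
have [|c cab ->] := @MVT R f df a b ab (fun x _ => fd x); last by exists c.
by apply: continuous_subspaceT => y; exact: derive_cont (fd y).
Qed.

Lemma fst_continuous (U V : topologicalType) : continuous (@fst U V).
Proof. by move=> p; exact: cvg_fst. Qed.

Lemma snd_continuous (U V : topologicalType) : continuous (@snd U V).
Proof. by move=> p; exact: cvg_snd. Qed.

Lemma pair_derive (g : R -> R * R) x : derivable g x 1 ->
  is_derive x 1 (fst \o g) (g^`() x).1 /\ is_derive x 1 (snd \o g) (g^`() x).2.
Proof.
rewrite /derivable => dg; rewrite derive1E /derive.
set F := fun h : R => _ in dg *.
have H1 : (fst \o F) h @[h --> 0^'] --> (lim (F @ 0^')).1.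
  exact: cvg_comp dg (@fst_continuous _ _ _).
have H2 : (snd \o F) h @[h --> 0^'] --> (lim (F @ 0^')).2.
  exact: cvg_comp dg (@snd_continuous _ _ _).
split; apply: DeriveDef.
- by apply/cvg_ex; exists (lim (F @ 0^')).1.
- exact: (cvg_lim (@norm_hausdorff _ _) H1).
- by apply/cvg_ex; exists (lim (F @ 0^')).2.
- exact: (cvg_lim (@norm_hausdorff _ _) H2).
Qed.

End Calculus.

(** * Ovals and the twist condition *)

Ltac order_lra :=
  repeat match goal with H : context [area_form _ _] |- _ => clear H end; lra.

Lemma int_squeeze (R : realType) (k : int) : -1 < k%:~R :> R -> k%:~R < 1 :> R -> k = 0.
Proof.
by rewrite -[-1]/((-1)%:~R) -[1]/(1%:~R) !ltr_int; lia.
Qed.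

Section AreaForm.
Variable R : realType.
Implicit Types u v w : R * R.

Lemma area_formC u v : area_form u v = - area_form v u.
Proof. by rewrite /area_form; ring. Qed.

Lemma area_formBr u v w : area_form u (v - w) = area_form u v - area_form u w.
Proof. by rewrite /area_form /=; ring. Qed.

Lemma area_formZl (k : R) u v : area_form (k *: u) v = k * area_form u v.
Proof.
have sE (x : R) : k *: x = k * x by [].
by rewrite /area_form /= !sE; ring.
Qed.

Lemma area_formZr (k : R) u v : area_form u (k *: v) = k * area_form u v.
Proof.
by rewrite area_formC area_formZl [area_form u v]area_formC mulrN.
Qed.

Lemma area_formvv u : area_form u u = 0.
Proof. by rewrite /area_form; ring. Qed.

Lemma area_form0r u : area_form u 0 = 0.
Proof. by rewrite /area_form /=; ring. Qed.

Lemma area_form_parallel u v : u != 0 -> area_form u v = 0 -> exists k, v = k *: u.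
Proof.
rewrite /area_form; case: u v => [a b] [c d] /= u0 /subr0_eq h.
have [a0|a0] := eqVneq a 0.
  have b0 : b != 0 by apply: contra u0 => /eqP ->; rewrite a0.
  exists (d / b); rewrite a0 /= in h *; congr (_, _) => /=.
    have : b * c = 0 by rewrite -h mul0r.
    by move=> /eqP; rewrite mulf_eq0 (negbTE b0) => /eqP ->; rewrite [RHS]mulr0.
  by rewrite [RHS]mulfVK.
exists (c / a); congr (_, _) => /=; first by rewrite [RHS]mulfVK.
by rewrite [RHS]mulrAC [c * b]mulrC -h mulrAC divff ?mul1r.
Qed.

End AreaForm.

Section Curve.
Variable R : realType.
Implicit Types g dg ddg : R -> R * R.

(* dg and ddg stand for the first and second derivatives of g. *)
Record oval g dg ddg : Prop := Oval {
  oval_eq : forall s t, g s = g t <-> exists k : int, s = t + k%:~R ;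
  oval_convex : forall s t, g s <> g t -> 0 < area_form (dg t) (g s - g t) ;
  oval_tangent_neq0 : forall t, dg t != 0 ;
  oval_tangent_periodic : forall t (k : int), dg (t + k%:~R) = dg t ;
  oval_derive : forall t : R, is_derive t 1 (fst \o g) (dg t).1 /\
    is_derive t 1 (snd \o g) (dg t).2 ;
  oval_tangent_derive : forall t : R, is_derive t 1 (fst \o dg) (ddg t).1 /\
    is_derive t 1 (snd \o dg) (ddg t).2 ;
  oval_acceleration_continuous : continuous (fst \o ddg) /\
    continuous (snd \o ddg) }.

Lemma curve_oval g : smooth_closed_curve g -> strictly_convex g ->
  positively_oriented g -> oval g (derive1 g) (derive1n 2 g).
Proof.
move=> [gd g0 ge] gx go; split.
- exact: ge.
- move=> s t st; case: (gx t) => /(_ s st) //.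
  by rewrite ltNge go.
- exact: g0.
- move=> t k; rewrite /derive1.
  suff -> : (fun h : R => h^-1 *: (g (h + (t + k%:~R)) - g (t + k%:~R))) =
    (fun h : R => h^-1 *: (g (h + t) - g t)) by [].
  have per x : g (x + k%:~R) = g x by apply/ge; exists k.
  by apply/funext => h; rewrite addrA !per.
- by move=> t; apply: pair_derive; exact: (gd 0%N t).
- by move=> t; have h := gd 1%N t; exact: pair_derive h.
- by split=> t; have h := gd 2%N t; have [d1 d2] := pair_derive h;
    [exact: derive_cont d1|exact: derive_cont d2].
Qed.

Lemma area_form_derive (f df : R -> R * R) (v : R * R) (x : R) :
  is_derive x 1 (fst \o f) (df x).1 /\ is_derive x 1 (snd \o f) (df x).2 ->
  is_derive x 1 (fun y => area_form v (f y)) (area_form v (df x)).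
Proof.
move=> [d1 d2]; rewrite /area_form.
have h1 := is_deriveZ v.1 d2.
have h2 := is_deriveZ v.2 d1.
exact: is_deriveB h1 h2.
Qed.

End Curve.

Section Oval.
Variables (R : realType) (g dg ddg : R -> R * R).
Hypothesis gP : oval g dg ddg.
Implicit Types r s t u x p q : R.

Lemma curve_eq s t : g s = g t <-> exists k : int, s = t + k%:~R.
Proof. exact: oval_eq gP _ _. Qed.

Lemma curve_periodic t (k : int) : g (t + k%:~R) = g t.
Proof. by apply/curve_eq; exists k. Qed.

Lemma tangent_periodic t (k : int) : dg (t + k%:~R) = dg t.
Proof. exact: oval_tangent_periodic gP _ _. Qed.

Lemma tangent_neq0 t : dg t != 0.
Proof. exact: oval_tangent_neq0 gP _. Qed.

Lemma curve_derive t : is_derive t 1 (fst \o g) (dg t).1 /\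
  is_derive t 1 (snd \o g) (dg t).2.
Proof. exact: oval_derive gP _. Qed.

Lemma tangent_derive t : is_derive t 1 (fst \o dg) (ddg t).1 /\
  is_derive t 1 (snd \o dg) (ddg t).2.
Proof. exact: oval_tangent_derive gP _. Qed.

Lemma area_form_curve_derive v x :
  is_derive x 1 (fun y => area_form v (g y)) (area_form v (dg x)).
Proof. exact: area_form_derive (curve_derive x). Qed.

Lemma area_form_tangent_derive v x :
  is_derive x 1 (fun y => area_form v (dg y)) (area_form v (ddg x)).
Proof. exact: area_form_derive (tangent_derive x). Qed.

Lemma area_form_tangent_continuous v : continuous (fun y => area_form v (dg y)).
Proof. by move=> x; exact: derive_cont (area_form_tangent_derive v x). Qed.

Lemma convex_gt0 s t : g s <> g t -> 0 < area_form (dg t) (g s - g t).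
Proof. exact: oval_convex gP _ _. Qed.

Lemma convex_ge0 s t : 0 <= area_form (dg t) (g s - g t).
Proof.
have [e|/convex_gt0/ltW//] := pselect (g s = g t).
by rewrite e subrr area_form0r.
Qed.

Lemma convex_gt0_itv s t : s < t < s + 1 -> 0 < area_form (dg s) (g t - g s).
Proof.
move=> /andP[st ts]; apply: convex_gt0 => /curve_eq[k] tk.
have k0 : k = 0 by apply: (@int_squeeze R); lra.
by move: st; rewrite tk k0 addr0 ltxx.
Qed.

(** If the tangent at [t] were a positive multiple of that at [s], convexity would put each point to
    the left of the other's tangent line, which is impossible. So the multiple is negative, and
    convexity at [t] bounds the height of the whole curve above the tangent line at [s]. *)
Lemma antiparallel_max s t r : s < t < s + 1 -> area_form (dg s) (dg t) = 0 ->
  area_form (dg s) (g r) <= area_form (dg s) (g t).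
Proof.
move=> st /(area_form_parallel (tangent_neq0 s))[k tk].
have h := convex_gt0_itv st.
have k0 : k < 0.
  have := convex_ge0 s t; rewrite tk.
  have -> : area_form (k *: dg s) (g s - g t) =
            - k * area_form (dg s) (g t - g s).
    by rewrite area_formZl !area_formBr; ring.
  rewrite pmulr_lge0 // oppr_ge0 le_eqVlt => /orP[/eqP k0|//].
  by have := tangent_neq0 t; rewrite tk k0 scale0r eqxx.
have := convex_ge0 r t; rewrite tk.
have -> : area_form (k *: dg s) (g r - g t) =
          - k * area_form (dg s) (g t - g r).
  by rewrite area_formZl !area_formBr; ring.
by rewrite pmulr_rge0 ?oppr_gt0 // area_formBr subr_ge0.
Qed.

Lemma antiparallel_uniq s t r : s < t < s + 1 -> s < r < s + 1 ->
  area_form (dg s) (dg t) = 0 -> area_form (dg s) (dg r) = 0 -> t = r.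
Proof.
move=> st sr t0 r0.
have e : area_form (dg s) (g t) = area_form (dg s) (g r).
  by apply/eqP; rewrite eq_le !antiparallel_max.
have [k rk] := area_form_parallel (tangent_neq0 s) r0.
have : ~ g t <> g r.
  move=> /convex_gt0; rewrite rk.
  have -> : area_form (k *: dg s) (g t - g r) =
    k * (area_form (dg s) (g t) - area_form (dg s) (g r)).
    by rewrite area_formZl !area_formBr; ring.
  by rewrite e subrr mulr0 ltxx.
move=> /contrapT /curve_eq[k' tk'].
by rewrite tk' (@int_squeeze R k') ?addr0 //; order_lra.
Qed.

(** [area_form (dg s) (dg p)] is the derivative of the height of [g p] above the tangent line at
    [s]. Over a period this height goes from zero to zero, is positive in between and has at most
    one critical point, so its derivative changes sign only from plus to minus. *)
Lemma tangent_pattern s p q : s < p -> p < q -> q < s + 1 ->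
  area_form (dg s) (dg p) <= 0 -> area_form (dg s) (dg q) < 0.
Proof.
move=> sp pq qs p0; rewrite ltNge; apply/negP => q0.
have cont := @area_form_tangent_continuous (dg s).
have [|r /andP[pr rq] r0] := ivt cont (ltW pq) (v := 0); first by rewrite p0 q0.
have uniq x : s < x < s + 1 -> area_form (dg s) (dg x) = 0 -> x = r.
  by move=> sx x0; apply: antiparallel_uniq x0 r0 => //; order_lra.
have der := @area_form_curve_derive (dg s).
have hr : 0 < area_form (dg s) (g r) - area_form (dg s) (g s).
  by rewrite -area_formBr convex_gt0_itv //; order_lra.
(* The height rises somewhere before [r] and falls somewhere after it; combined with the sign at [p]
   or [q], this yields a second zero. *)
have [rp|pr'] : p = r \/ p < r by case: (ltgtP p r) pr => // *; [right|left].
  have [c /andP[rc cs] e] := mvt der (a := r) (b := s + 1) ltac:(order_lra).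
  have c0 : area_form (dg s) (dg c) < 0.
    have : area_form (dg s) (dg c) * (s + 1 - r) < 0.
      by rewrite -e -[1]/(1%:~R) curve_periodic -opprB oppr_lt0.
    by rewrite pmulr_llt0 //; order_lra.
  have [cq|qc] := leP c q.
    have [|x /andP[x1 x2] x0] := ivt cont cq (v := 0); first by rewrite q0 ltW.
    by have := uniq x ltac:(order_lra) x0; order_lra.
  have [|x /andP[x1 x2] x0] := ivt_dec cont (ltW qc) (v := 0); first by rewrite q0 ltW.
  have xr := uniq x ltac:(order_lra) x0; order_lra.
have [c /andP[sc cr] e] := mvt der (a := s) (b := r) ltac:(order_lra).
have c0 : 0 < area_form (dg s) (dg c).
  have : 0 < area_form (dg s) (dg c) * (r - s) by rewrite -e.
  by rewrite pmulr_lgt0 //; order_lra.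
have [cp|pc] := leP c p.
  have [|x /andP[x1 x2] x0] := ivt_dec cont cp (v := 0); first by rewrite p0 ltW.
  by have := uniq x ltac:(order_lra) x0; order_lra.
have [|x /andP[x1 x2] x0] := ivt cont (ltW pc) (v := 0); first by rewrite p0 ltW.
have xr := uniq x ltac:(order_lra) x0; order_lra.
Qed.

(* Parameters (s, t) of a point (g s, g t) of the phase space. *)
Definition chord s t := [/\ s < t, t < s + 1 & 0 < area_form (dg s) (dg t)].

(** The condition says that the tangent turns by less than a half-turn from [s] to [t], which passes
    to shorter arcs. The two ends are moved one at a time. *)
Lemma chord_sub s t s' t' : chord s t -> s <= s' -> s' < t' -> t' <= t -> chord s' t'.
Proof.
move=> [st ts h] ss st' tt.
have c : chord s t'.
  split; [order_lra|order_lra|].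
  have [->//|t't] := eqVneq t' t.
  have {t't} t't : t' < t by rewrite lt_neqAle t't.
  rewrite ltNge; apply/negP => /(@tangent_pattern s t' t ltac:(order_lra) t't ts).
  by rewrite ltNge ltW.
case: c => {tt st ts h} st ts h.
have [->//|s's] := eqVneq s' s.
have {s's} s's : s < s' by rewrite lt_neqAle eq_sym s's.
split; [order_lra|order_lra|].
(* Seen from the base point [t' - 1], both [s] and [s'] lie ahead within one period, so
   [tangent_pattern] also handles the left end. *)
have e : dg (t' - 1) = dg t' by rewrite -[- 1]/((-1)%:~R) tangent_periodic.
have := @tangent_pattern (t' - 1) s s' ltac:(order_lra) s's ltac:(order_lra).
rewrite e (area_formC (dg t') (dg s)) (area_formC (dg t') (dg s')).
by move: (area_form _ _) (area_form _ _) h => /= x y; lra.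
Qed.

(* The derivative in t of the action omega(g s, g t) + omega(g t, g u): the
   billiard maps (g s, g t) to (g t, g u) exactly when act s t u = 0. *)
Definition act s t u := area_form (dg t) (g u - g s).

(** The twist condition: the derivative of [act] in an outer argument is the area form of two
    tangents, positive along every chord between the extreme positions. *)
Lemma act_lt_l s1 s2 t u : chord s1 t -> s1 < s2 -> s2 < t -> act s1 t u < act s2 t u.
Proof.
move=> c s12 s2t; rewrite /act !area_formBr ltrD2l ltrN2 -subr_lt0.
have [x /andP[x1 x2] ->] := mvt (@area_form_curve_derive (dg t)) s12.
have [_ _] := @chord_sub s1 t x t c (ltW x1) ltac:(order_lra) (lexx t).
rewrite (area_formC (dg t)) => h.
by rewrite mulNr oppr_lt0; apply: mulr_gt0 => //; order_lra.
Qed.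

Lemma act_lt_r s t u1 u2 : chord t u2 -> u1 < u2 -> t < u1 -> act s t u1 < act s t u2.
Proof.
move=> c u12 tu; rewrite /act !area_formBr ltrD2r -subr_gt0.
have [x /andP[x1 x2] ->] := mvt (@area_form_curve_derive (dg t)) u12.
have [_ _] := @chord_sub t u2 t x c (lexx t) ltac:(order_lra) (ltW x2).
by move=> h; apply: mulr_gt0 => //; order_lra.
Qed.

Lemma act_le_l s1 s2 t u : chord s1 t -> s1 <= s2 -> s2 < t -> act s1 t u <= act s2 t u.
Proof.
move=> c; rewrite le_eqVlt => /orP[/eqP->//|s12 s2t].
exact/ltW/act_lt_l.
Qed.

Lemma act_le_r s t u1 u2 : chord t u2 -> u1 <= u2 -> t < u1 -> act s t u1 <= act s t u2.
Proof.
move=> c; rewrite le_eqVlt => /orP[/eqP->//|u12 tu].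
exact/ltW/act_lt_r.
Qed.

Lemma act_periodic s t u (i j k : int) :
  act (s + i%:~R) (t + j%:~R) (u + k%:~R) = act s t u.
Proof. by rewrite /act !curve_periodic tangent_periodic. Qed.

End Oval.

(** * Running maxima and Stieltjes integrals *)

Section RealFunctions.
Variable R : realType.
Implicit Types (f : R -> R) (x y : R).

Lemma mvt_le f df a b : (forall x, is_derive x 1 f (df x)) -> a <= b ->
  exists2 c, a <= c <= b & f b - f a = df c * (b - a).
Proof.
move=> fd; rewrite le_eqVlt => /orP[/eqP<-|ab].
  by exists a; rewrite ?lexx // !subrr mulr0.
by have [c /andP[ac cb] e] := mvt fd ab; exists c => //; rewrite !ltW.
Qed.

Lemma bounded_segment f a b : continuous f ->
  exists2 K, 0 <= K & forall x, a <= x <= b -> `|f x| <= K.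
Proof.
move=> fc; have [ab|ab] := leP a b; last first.
  by exists 0 => // x /andP[ax xb]; have := le_lt_trans (le_trans ax xb) ab; rewrite ltxx.
have nfc : {within `[a, b], continuous (fun x => `|f x|)}.
  apply: continuous_subspaceT => x; apply: continuous_comp (fc x) _.
  exact: norm_continuous.
have [c _ cm] := EVT_max ab nfc.
by exists `|f c| => // x xab; apply: cm; rewrite in_itv.
Qed.

Lemma quasi_periodic f (c : R) : (forall x, f (x + 1) = f x + c) ->
  forall x (k : int), f (x + k%:~R) = f x + c * k%:~R.
Proof.
move=> fc.
have nat x (n : nat) : f (x + n%:R) = f x + c * n%:R.
  elim: n => [|n IH]; first by rewrite mulr0 !addr0.
  by rewrite -natr1 addrA fc IH; ring.
move=> x [n|n]; first exact: nat.
rewrite NegzE mulrNz; have := nat (x - n.+1%:R) n.+1.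
by rewrite subrK => ->; ring.
Qed.

Lemma quasi_periodic_surj f (c : R) : continuous f -> 0 < c ->
  (forall x, f (x + 1) = f x + c) -> forall y, exists x : R, f x = y.
Proof.
move=> fc c0 fper y.
have /andP[n1 n2] := floor_itv ((y - f 0) / c).
set n := Num.floor _ in n1 n2.
have [||x _ <-] := @ivt R f (0 + n%:~R) (0 + (n + 1)%:~R) y fc; last by exists x.
  by rewrite !add0r ler_int; lia.
move: n1 n2; rewrite ler_pdivlMr // ltr_pdivrMr // => n1 n2.
rewrite !(quasi_periodic fper) [c * n%:~R]mulrC [c * _]mulrC; lra.
Qed.

Lemma running_max f (c : R) : continuous f -> 0 < c ->
  (forall x, f (x + 1) = f x + c) ->
  exists M : R -> R, (forall x y, y <= x -> f y <= M x) /\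
    (forall x, exists2 y, y <= x & f y = M x).
Proof.
move=> fc c0 fper.
have /choice[m mP] : forall x, exists y, y <= x /\ forall z, z <= x -> f z <= f y.
  move=> x.
  (* One period suffices: since [c > 0], moving [z] by whole periods into [[x - 1, x]] does not
     decrease [f]. *)
  have [|y] := @EVT_max R f (x - 1) x _ (continuous_subspaceT fc); first lra.
  rewrite in_itv /= => /andP[_ yx] ym; exists y; split => // z zx.
  have /andP[n1 n2] := floor_itv (x - z); set n := Num.floor (x - z) in n1 n2.
  have n0 : 0 <= n by rewrite /n floor_ge0; lra.
  rewrite intrD in n2.
  apply: le_trans (ym (z + n%:~R) _); last by rewrite in_itv /=; lra.
  by rewrite (quasi_periodic fper) lerDl mulr_ge0 ?ler0z // ltW.
exists (f \o m); split => [x y yx|x]; first by apply: (mP x).2.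
by exists (m x) => //; exact: (mP x).1.
Qed.

Section RunningMax.
Variables (f M : R -> R) (c : R).
Hypotheses (fc : continuous f) (fper : forall x, f (x + 1) = f x + c)
  (Mub : forall x y, y <= x -> f y <= M x)
  (Matt : forall x, exists2 y, y <= x & f y = M x).

Lemma running_max_homo x y : x <= y -> M x <= M y.
Proof. by move=> xy; have [z zx <-] := Matt x; apply: Mub; lra. Qed.

Lemma running_max_periodic x : M (x + 1) = M x + c.
Proof.
apply/eqP; rewrite eq_le; apply/andP; split.
  have [z zx <-] := Matt (x + 1).
  by rewrite -(subrK 1 z) fper lerD2r; apply: Mub; lra.
by have [z zx <-] := Matt x; rewrite -fper; apply: Mub; lra.
Qed.

(** If the maximum grows between two nearby points, the larger value is attained between them, where
    [f] is close to its value at the left one. *)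
Lemma running_max_continuous : continuous M.
Proof.
move=> x; apply/continuous_distP => e e0.
have [d d0 fd] := (continuous_distP f x).1 (@fc x) (e / 2) ltac:(lra).
have fd' z : `|z - x| < d -> f x - e / 2 < f z < f x + e / 2.
  by move=> /fd; rewrite ltr_norml; lra.
exists d => // y; rewrite ltr_norml => /andP[y1 y2]; rewrite ltr_norml.
have [xy|yx] := leP x y.
  have := running_max_homo xy; have := Mub (lexx x).
  have [z zy <-] := Matt y.
  have [zx|xz] := leP z x; first by have := Mub zx; lra.
  by have := fd' z; rewrite ltr_norml => /(_ ltac:(lra)); lra.
have := running_max_homo (ltW yx); have := Mub (lexx y).
have := fd' y; rewrite ltr_norml => /(_ ltac:(lra)).
have [z zy <-] := Matt x.
have [zx|xz] := leP z y; first by have := Mub zx; lra.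
by have := fd' z; rewrite ltr_norml => /(_ ltac:(lra)); lra.
Qed.

End RunningMax.

(* Bisecting [l, r] with respect to the values of V halves the total error at
   each step. *)
Lemma quadratic_increment_homo (H V : R -> R) C l r : continuous V ->
  (forall x y, x <= y -> V x <= V y) -> l <= r ->
  (forall x y, l <= x -> x <= y -> y <= r -> - C * (V y - V x) ^+ 2 <= H y - H x) ->
  H l <= H r.
Proof.
move=> Vc Vh lr HV.
have half n : forall x y, l <= x -> x <= y -> y <= r ->
    - C * (V y - V x) ^+ 2 / 2 ^+ n <= H y - H x.
  elim: n => [|n IH] x y lx xy yr; first by rewrite expr0 divr1 HV.
  have Vxy := Vh _ _ xy.
  have [|z /andP[xz zy] Vz] := ivt Vc xy (v := (V x + V y) / 2); first lra.
  have h1 := IH x z lx xz ltac:(lra).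
  have h2 := IH z y ltac:(lra) zy yr.
  apply: le_trans (_ : _ <= (H y - H z) + (H z - H x)) _; last by lra.
  apply: le_trans (lerD h2 h1).
  rewrite Vz (exprS 2 n) invfM le_eqVlt; apply/orP; left; apply/eqP.
  by field; rewrite expf_neq0.
set B := C * (V r - V l) ^+ 2.
have {}half n : - B / 2 ^+ n <= H r - H l by rewrite /B -mulNr; exact: half.
rewrite -subr_ge0 leNgt; apply/negP => Hneg.
have [n nB] : exists n : nat, B / (H l - H r) < n%:R.
  exists (Num.bound (B / (H l - H r))); apply: archi_boundP.
  by rewrite divr_ge0 //; last lra; move: (half 0%N); rewrite expr0 divr1; lra.
have := half n; rewrite ler_pdivrMr ?exprn_gt0 //.
move: nB; rewrite ltr_pdivrMr; last lra.
have : (n%:R : R) <= 2 ^+ n by rewrite -natrX ler_nat ltnW // ltn_expl.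
move: (2 ^+ n : R) (n%:R : R) => p q; nra.
Qed.

Section Stieltjes.
Variables (p M : R -> R) (c : R).
Hypotheses (pc : continuous p) (c0 : 0 < c)
  (Mh : forall x y, x <= y -> M x <= M y) (Mper : forall x, M (x + 1) = M x + c).

Let low y : set R := [set x | M x <= y].

Let low_sup y : has_sup (low y).
Proof.
have [n nP] : exists n : nat, `|y - M 0| / c < n%:R.
  by exists (Num.bound (`|y - M 0| / c)); rewrite archi_boundP ?divr_ge0 // ltW.
move: nP; rewrite ltr_pdivrMr // ltr_norml => /andP[n1 n2].
split.
  exists (- n%:R); rewrite /low /=.
  have := quasi_periodic Mper 0 (- n%:Z).
  by rewrite mulrNz add0r => ->; lra.
exists n%:R => x; rewrite /low /= => xy; rewrite leNgt; apply/negP => /ltW /Mh.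
have := quasi_periodic Mper 0 n%:Z.
by rewrite add0r -[n%:Z%:~R]/(n%:R) => ->; lra.
Qed.

(** The generalized inverse of [M]. Substituting y = M x turns the Stieltjes integral of [p] against
    [M] into the Lebesgue integral of [p \o inv] over an interval of values of [M]. *)
Let inv y := sup (low y).

Let inv_ge x y : M x <= y -> x <= inv y.
Proof. by move=> xy; apply: ub_le_sup => //; exact: (low_sup y).2. Qed.

Let inv_le x y : y < M x -> inv y <= x.
Proof.
move=> yx; apply: ge_sup; first exact: (low_sup y).1.
move=> z; rewrite /low /= => zy; rewrite leNgt; apply/negP => /ltW /Mh; lra.
Qed.

Let inv_homo x y : x <= y -> inv x <= inv y.
Proof.
move=> xy; apply: ge_sup; first exact: (low_sup x).1.
by move=> z; rewrite /low /= => zx; apply: inv_ge; lra.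
Qed.

Let inv_measurable (D : set R) : measurable D -> measurable_fun D (p \o inv).
Proof.
move=> mD; apply: measurableT_comp; first exact: continuous_measurable_fun.
exact: nondecreasing_measurable.
Qed.

(** The interval is open on the right because [inv (M b)] exceeds [b] when [M] is constant just
    after [b]. *)
Let inv_integrable a b : M a <= M b ->
  lebesgue_measure.-integrable `[M a, M b[%classic (EFin \o (p \o inv)).
Proof.
move=> ab; apply: measurable_bounded_integrable => //.
- rewrite /= lebesgue_measure_itv /=.
  by case: ifPn => // _; rewrite -EFinB ltry.
- exact: inv_measurable.
have [K K0 Kp] := @bounded_segment p a b pc.
exists K; split; first exact: num_real.
move=> y Ky x /=; rewrite in_itv /= => /andP[ax xb].
by apply: le_trans (ltW Ky); apply: Kp; rewrite inv_ge ?inv_le.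
Qed.

(* S is the indefinite Stieltjes integral of p with respect to M. *)
Lemma stieltjes_mean A : exists S : R -> R, forall a b, A <= a -> a <= b ->
  exists2 x, a <= x <= b & S b - S a = p x * (M b - M a).
Proof.
pose mu := @lebesgue_measure R.
(* For [x < A] the interval is empty, hence the restriction to points beyond [A]. *)
exists (fun x => \int[mu]_(y in `[M A, M x[) (p \o inv) y)%R => a b Aa ab.
have -> : (\int[mu]_(y in `[M A, M b[) (p \o inv) y =
    \int[mu]_(y in `[M A, M a[) (p \o inv) y +
    \int[mu]_(y in `[M a, M b[) (p \o inv) y)%R.
  have e : `[M A, M b[%classic = `[M A, M a[%classic `|` `[M a, M b[%classic.
    apply/seteqP; split => x /=; rewrite !in_itv /=.
      by move=> /andP[-> ->]; rewrite andbT /=; case: (ltP x (M a)); [left|right].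
    have h1 := Mh Aa; have h2 := Mh ab.
    by move=> [] /andP[? ?]; apply/andP; split; lra.
  rewrite e Rintegral_setU // -?e.
    by apply: inv_integrable; apply: Mh; lra.
  apply/disj_setPS => x /=; rewrite !in_itv /= => -[/andP[_ h1] /andP[h2 _]].
  lra.
rewrite addrAC subrr add0r.
pose I := (\int[mu]_(y in `[M a, M b[) (p \o inv) y)%R; rewrite -/I.
have int := inv_integrable (Mh ab).
have cst_int k : mu.-integrable `[M a, M b[%classic (EFin \o cst k).
  apply: measurable_bounded_integrable => //.
    rewrite /= lebesgue_measure_itv /=.
    by case: ifPn => // _; rewrite -EFinB ltry.
  by exists `|k|; split; [exact: num_real|move=> y Ky x _; exact: ltW].
have cstE k : (\int[mu]_(y in `[M a, M b[) (cst k) y)%R = k * (M b - M a).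
  rewrite Rintegral_cst //; congr (_ * _).
  rewrite /= lebesgue_measure_itv /=; case: ifPn; rewrite lte_fin -?leNgt //.
  by move=> h; have := Mh ab; rewrite /=; lra.
have pcw := continuous_subspaceT pc : {within `[a, b], continuous p}.
have [x1] := EVT_min ab pcw; rewrite in_itv /= => /andP[ax1 x1b] min1.
have [x2] := EVT_max ab pcw; rewrite in_itv /= => /andP[ax2 x2b] max2.
have lo : p x1 * (M b - M a) <= I.
  rewrite -cstE; apply: le_Rintegral => // y /=; rewrite in_itv /= => /andP[y1 y2].
  by apply: min1; rewrite in_itv /= inv_ge ?inv_le.
have hi : I <= p x2 * (M b - M a).
  rewrite -cstE; apply: le_Rintegral => // y /=; rewrite in_itv /= => /andP[y1 y2].
  by apply: max2; rewrite in_itv /= inv_ge ?inv_le.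
have := Mh ab; rewrite -subr_ge0 le_eqVlt => /orP[/eqP e|Mab].
  exists a; rewrite ?lexx //; move: lo hi; rewrite -e !mulr0 => lo hi.
  by apply/eqP; rewrite eq_le lo hi.
have v : p x1 <= I / (M b - M a) <= p x2 by rewrite ler_pdivlMr // ler_pdivrMr // lo hi.
have mm : Num.min x1 x2 <= Num.max x1 x2 by rewrite le_max ge_min lexx.
have [|x] := IVT mm (continuous_subspaceT pc) (v := I / (M b - M a)).
  by rewrite ge_min le_max; case: (leP x1 x2) => _; case/andP: v => -> ->; rewrite ?orbT.
rewrite in_itv /= => /andP[h1 h2] e; exists x.
  apply/andP; split.
    by apply: le_trans h1; rewrite le_min ax1 ax2.
  by apply: le_trans h2 _; rewrite ge_max x1b x2b.
by rewrite e divfK // gt_eqF.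
Qed.

End Stieltjes.

End RealFunctions.

(** * Monotonicity of invariant curves *)

Section Estimates.
Variable R : realType.

Lemma mvt_in (f df : R -> R) (lo hi a b : R) : (forall x : R, is_derive x 1 f (df x)) ->
  lo <= a <= hi -> lo <= b <= hi ->
  exists2 c, lo <= c <= hi & f b - f a = df c * (b - a).
Proof.
move=> fd /andP[a1 a2] /andP[b1 b2]; have [ab|ba] := leP a b.
  have [c /andP[c1 c2] e] := mvt_le fd ab.
  by exists c => //; lra.
have [c /andP[c1 c2] e] := mvt_le fd (ltW ba).
by exists c; [lra|rewrite -opprB e -mulrN opprB].
Qed.

Lemma area_form_bound (u v : R * R) K : `|u.1| <= K -> `|u.2| <= K ->
  `|v.1| <= K -> `|v.2| <= K -> `|area_form u v| <= K ^+ 2 + K ^+ 2.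
Proof.
move=> u1 u2 v1 v2; rewrite /area_form.
apply: le_trans (ler_normB _ _) _; rewrite !normrM !expr2.
by apply: lerD; apply: ler_pM.
Qed.

Variables (g dg ddg : R -> R * R).
Hypothesis gP : oval g dg ddg.

(** Supplies the error constant in [max_no_growth]: displacing the arguments within a step costs [C]
    times an increment, and multiplying by another increment makes the error quadratic. *)
Lemma action_lipschitz lo hi : exists2 C, 0 <= C & forall x y x' y',
  lo <= x <= hi -> lo <= y <= hi -> lo <= x' <= hi -> lo <= y' <= hi ->
  `|area_form (dg x) (g y) - area_form (dg x') (g y')| <=
    C * (`|x - x'| + `|y - y'|).
Proof.
have bnd (f df : R -> R * R) : (forall t : R, is_derive t 1 (fst \o f) (df t).1 /\
    is_derive t 1 (snd \o f) (df t).2) ->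
    exists2 K, 0 <= K & forall x, lo <= x <= hi -> `|(f x).1| <= K /\ `|(f x).2| <= K.
  move=> fd.
  have [x|K1 K10 f1] := @bounded_segment _ (fst \o f) lo hi.
    exact: derive_cont (fd x).1.
  have [x|K2 K20 f2] := @bounded_segment _ (snd \o f) lo hi.
    exact: derive_cont (fd x).2.
  exists (K1 + K2); first exact: addr_ge0.
  by move=> x xl; have := f1 x xl; have := f2 x xl; rewrite /=; lra.
have [K1 K10 h1] := bnd _ _ (curve_derive gP).
have [K2 K20 h2] := bnd _ _ (tangent_derive gP).
have [c1 c2] := oval_acceleration_continuous gP.
have [K3 K30 h3] := bounded_segment lo hi c1.
have [K4 K40 h4] := bounded_segment lo hi c2.
pose K := K1 + K2 + K3 + K4.
have hg x : lo <= x <= hi -> `|(g x).1| <= K /\ `|(g x).2| <= K.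
  by move=> /h1; rewrite /K; lra.
have hdg x : lo <= x <= hi -> `|(dg x).1| <= K /\ `|(dg x).2| <= K.
  by move=> /h2; rewrite /K; lra.
have hddg x : lo <= x <= hi -> `|(ddg x).1| <= K /\ `|(ddg x).2| <= K.
  by move=> xl; have := h3 x xl; have := h4 x xl; rewrite /K /=; lra.
exists (K ^+ 2 + K ^+ 2); first by rewrite addr_ge0 // sqr_ge0.
move=> x y x' y' xl yl x'l y'l.
rewrite -(subrKA (area_form (dg x') (g y))) mulrDr.
apply: le_trans (ler_normD _ _) _; apply: lerD.
  rewrite (area_formC (dg x)) (area_formC (dg x')) opprK addrC.
  have [c cl ->] := mvt_in (area_form_tangent_derive gP (g y)) xl x'l.
  rewrite normrM [`|x - x'|]distrC; apply: ler_wpM2r => //.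
  by apply: area_form_bound; [apply: (hg _ _).1|apply: (hg _ _).2|
    apply: (hddg _ _).1|apply: (hddg _ _).2].
have [c cl ->] := mvt_in (area_form_curve_derive gP (dg x')) y'l yl.
rewrite normrM; apply: ler_wpM2r => //.
by apply: area_form_bound; [apply: (hdg _ _).1|apply: (hdg _ _).2|
  apply: (hdg _ _).1|apply: (hdg _ _).2].
Qed.

End Estimates.

Section Core.
Variables (R : realType) (g dg ddg : R -> R * R).
Hypothesis gP : oval g dg ddg.

Lemma curve_continuous : continuous (fst \o g) /\ continuous (snd \o g).
Proof.
by split=> x; have [d1 d2] := curve_derive gP x;
  [exact: derive_cont d1|exact: derive_cont d2].
Qed.

Lemma tangent_continuous : continuous (fst \o dg) /\ continuous (snd \o dg).
Proof.
by split=> x; have [d1 d2] := tangent_derive gP x;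
  [exact: derive_cont d1|exact: derive_cont d2].
Qed.

Lemma action_continuous (u v : R -> R) : continuous u -> continuous v ->
  continuous (fun x => area_form (dg (u x)) (g (v x))).
Proof.
move=> uc vc x; rewrite /area_form.
have [g1 g2] := curve_continuous; have [h1 h2] := tangent_continuous.
apply: cvgB; apply: cvgM.
- exact: (continuous_comp (@uc x) (@h1 (u x))).
- exact: (continuous_comp (@vc x) (@g2 (v x))).
- exact: (continuous_comp (@uc x) (@h2 (u x))).
- exact: (continuous_comp (@vc x) (@g1 (v x))).
Qed.

Lemma act_shift_tangent s t u (k : int) : act g dg s (t - k%:~R) u = act g dg s t u.
Proof.
by have := act_periodic gP s t u 0 (- k) 0; rewrite !addr0 mulrNz.
Qed.

Lemma act_shift_end s t u (k : int) : act g dg s t (u - k%:~R) = act g dg s t u.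
Proof.
by have := act_periodic gP s t u 0 0 (- k); rewrite !addr0 mulrNz.
Qed.

Variables (a phi : R -> R) (d j : int).

(* The invariant curve is x |-> (g (a x), g (a (phi x))), where phi lifts the
   restriction of the billiard map to the curve. The lift a of the first
   component has degree d, and a (phi x) is the lift of the second component up
   to the integer shift j. *)
Record invariant_orbits : Prop := InvariantOrbits {
  inv_continuous : continuous a ;
  inv_map_continuous : continuous phi ;
  inv_degree_neq0 : d != 0 ;
  inv_periodic : forall x, a (x + 1) = a x + d%:~R ;
  inv_map_periodic : forall x, phi (x + 1) = phi x + 1 ;
  inv_map_lt : forall x y, x < y -> phi x < phi y ;
  inv_chord : forall x, chord dg (a x) (a (phi x) - j%:~R) ;
  inv_act : forall x, act g dg (a x) (a (phi x)) (a (phi (phi x))) = 0 ;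
  inv_inj : forall x y, a x = a y -> a (phi x) = a (phi y) -> x = y }.

Hypotheses (aP : invariant_orbits) (d_gt0 : (0 < d)%R).

Let ac := inv_continuous aP.
Let phic := inv_map_continuous aP.
Let d0 : 0 < d%:~R :> R. Proof. by rewrite ltr0z. Qed.
Let aper := inv_periodic aP.
Let phiper := inv_map_periodic aP.
Let phi_lt := inv_map_lt aP.

Let phi_le x y : x <= y -> phi x <= phi y.
Proof. by rewrite le_eqVlt => /orP[/eqP->//|/phi_lt/ltW]. Qed.

Let phi_surj y : exists x, phi x = y.
Proof. exact: (quasi_periodic_surj phic ltr01 phiper). Qed.

Section Maximum.
Variable M : R -> R.
Hypotheses (Mub : forall x y, y <= x -> a y <= M x)
  (Matt : forall x, exists2 y, y <= x & a y = M x).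

Let Mh := running_max_homo Mub Matt.
Let Mc := running_max_continuous ac Mub Matt.
Let Mper := running_max_periodic aper Mub Matt.

(** If [M (phi x) = a (phi r)], then [r <= x] and [a r <= M x], so this is a subarc of the chord at
    [r]. It is nondegenerate because [M x] is itself a value [a s] with [s <= x]. *)
Lemma max_chord x : chord dg (M x) (M (phi x) - j%:~R).
Proof.
have [s sx es] := Matt x; have [r' r'x er] := Matt (phi x).
have [r e] := phi_surj r'; rewrite -e in er r'x.
have rx : r <= x by rewrite leNgt; apply/negP => /phi_lt; lra.
have [h1 _ _] := inv_chord aP s; have h2 := Mub (phi_le sx).
have := inv_chord aP r; rewrite er => h; apply: (chord_sub gP h) => //.
- exact: Mub.
- by rewrite es in h1; lra.
Qed.


(** The orbit through [y] has the same middle point, and its outer points are at most those given by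
    [M]; the twist condition compares the two values of [act]. The strict form is what [max_lt] uses
    at the end of a plateau. *)
Lemma max_act_ge0 x y : y <= x -> a (phi y) = M (phi x) ->
  0 <= act g dg (M x) (M (phi x)) (M (phi (phi x))) /\
  (a (phi (phi y)) < M (phi (phi x)) ->
    0 < act g dg (M x) (M (phi x)) (M (phi (phi x)))).
Proof.
move=> yx e.
have := inv_act aP y; rewrite e.
have cy := inv_chord aP y; have cpy := inv_chord aP (phi y).
have cx := max_chord x; have cpx := max_chord (phi x); rewrite e in cy cpy.
have le1 : act g dg (a y) (M (phi x)) (a (phi (phi y))) <=
    act g dg (M x) (M (phi x)) (a (phi (phi y))).
  (* The shift by [j] brings the points into one period, as [chord] demands; [act] does not see
     it. *)
  rewrite -(act_shift_tangent _ _ _ j) -(act_shift_tangent (M x) _ _ j).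
  by apply: (act_le_l gP _ cy); [exact: Mub|case: cx].
have le2 : a (phi (phi y)) <= M (phi (phi x)) by apply: Mub; do 2!apply: phi_le.
have [h _ _] := cpy.
move=> e0; rewrite e0 in le1; split.
  apply: le_trans le1 _.
  rewrite -(act_shift_end _ _ _ j) -(act_shift_end _ _ (M _) j).
  by apply: (act_le_r gP _ cpx) => //; lra.
move=> lt2; apply: le_lt_trans le1 _.
rewrite -(act_shift_end _ _ _ j) -(act_shift_end _ _ (M _) j).
by apply: (act_lt_r gP _ cpx) => //; lra.
Qed.

(* Since act increases with its outer arguments, replacing the lift a by its
   running maximum M turns the orbit equation into an inequality. *)
Lemma max_subsolution x : 0 <= act g dg (M x) (M (phi x)) (M (phi (phi x))).
Proof.
have [z' zx e] := Matt (phi x); have [z ez] := phi_surj z'.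
rewrite -ez in zx e; apply: (max_act_ge0 _ e).1.
by rewrite leNgt; apply/negP => /phi_lt; lra.
Qed.

Let Mh' x y : x <= y -> M x <= M y. Proof. exact: Mh. Qed.
Let Nh x y : x <= y -> M (phi x) <= M (phi y). Proof. by move=> xy; apply/Mh/phi_le. Qed.
Let Nc : continuous (M \o phi).
Proof. by move=> x; exact: (continuous_comp (@phic x) (@Mc (phi x))). Qed.

(* D x = omega(g (M x), g (N x)) - S x + S (phi x), with N = M o phi and S a
   primitive of omega(g' (M x), g (N x)) dM, satisfies dD = act (M, N, N o phi) dN
   and D (x + 1) = D x, so act (M, N, N o phi) >= 0 vanishes where N grows. *)
Lemma max_no_growth (c x0 y0 : R) : 0 < c -> x0 <= y0 -> y0 <= x0 + 1 ->
  (forall x : R, x0 <= x <= y0 -> c <= act g dg (M x) (M (phi x)) (M (phi (phi x)))) ->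
  M (phi y0) <= M (phi x0).
Proof.
move=> c0 xy0 yx0 actc.
(* [V] is a common clock: the increments of both [M] and [N] are bounded by those of [V]. *)
pose N x := M (phi x); pose V x := M x + N x.
pose p x := area_form (dg (M x)) (g (N x)).
have pc : continuous p by apply: action_continuous; [exact: Mc|exact: Nc].
have pper x : p (x + 1) = p x.
  by rewrite /p /N phiper !Mper (tangent_periodic gP) (curve_periodic gP).
have Vh x y : x <= y -> V x <= V y by move=> xy; apply: lerD; [exact: Mh|exact: Nh].
have Vc : continuous V by move=> x; apply: cvgD; [exact: Mc|exact: Nc].
(* [[A, B + 1]] contains one period from [x0] and its image under [phi], so both [S] and [S \o phi]
   are covered. *)
pose A := Num.min x0 (phi x0); pose B := Num.max x0 (phi x0).
have [Ax0 x0B] : A <= x0 /\ x0 <= B by rewrite ge_min le_max lexx.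
have [Ap pB] : A <= phi x0 /\ phi x0 <= B by rewrite ge_min le_max lexx !orbT.
have [S SP] := stieltjes_mean pc d0 Mh' Mper A.
pose lo := Num.min (M A) (N A); pose hi := Num.max (M (B + 1)) (N (B + 1)).
have [C C0 CP] := action_lipschitz gP lo hi.
have win x : A <= x -> x <= B + 1 -> lo <= M x <= hi /\ lo <= N x <= hi.
  move=> Ax xB; rewrite !ge_min !le_max !(Mh' Ax) !(Mh' xB) !(Nh Ax) !(Nh xB).
  by rewrite !orbT.
have osc (f : R -> R) x y z w : (forall x y, x <= y -> f x <= f y) ->
    x <= z <= y -> x <= w <= y -> `|f z - f w| <= f y - f x.
  move=> fh /andP[z1 z2] /andP[w1 w2]; rewrite ler_norml.
  have := fh _ _ z1; have := fh _ _ z2; have := fh _ _ w1; have := fh _ _ w2; lra.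
have Mosc x y z w : x <= z <= y -> x <= w <= y -> `|M z - M w| <= M y - M x.
  exact: (osc M).
have Nosc x y z w : x <= z <= y -> x <= w <= y -> `|N z - N w| <= N y - N x.
  exact: (osc N).
have Posc e xi xi' eta eta' : `|xi - xi'| + `|eta - eta'| <= e ->
    lo <= xi <= hi -> lo <= eta <= hi -> lo <= xi' <= hi -> lo <= eta' <= hi ->
    `|area_form (dg xi) (g eta) - area_form (dg xi') (g eta')| <= C * e.
  move=> h b1 b2 b3 b4.
  by apply: le_trans (CP _ _ _ _ b1 b2 b3 b4) _; apply: ler_wpM2l.
(* The integral over a period does not depend on its starting point: [H] and [- H] are both
   nondecreasing up to a quadratic error, so [H A = H B]. *)
have Sper : S (x0 + 1) - S x0 = S (phi x0 + 1) - S (phi x0).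
  pose H x := S (x + 1) - S x.
  have incr x y : A <= x -> x <= y -> y <= B ->
      `|H y - H x| <= C * (V y - V x) ^+ 2.
    move=> Ax xy yB.
    have [z' /andP[z1 z2] ez] := SP (x + 1) (y + 1) ltac:(lra) ltac:(lra).
    have [w /andP[w1 w2] ew] := SP x y Ax xy.
    have [z z'E] : exists z, z' = z + 1 by exists (z' - 1); rewrite subrK.
    rewrite z'E pper in z1 z2 ez; rewrite !lerD2r in z1 z2.
    have -> : H y - H x = (p z - p w) * (M y - M x).
      have -> : H y - H x = (S (y + 1) - S (x + 1)) - (S y - S x) by rewrite /H; ring.
      by rewrite ez ew !Mper; ring.
    rewrite normrM expr2 mulrA; apply: ler_pM => //.
      have winxy u : x <= u -> u <= y -> lo <= M u <= hi /\ lo <= N u <= hi.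
        move=> u1 u2; apply: win; first exact: le_trans u1.
        by apply: le_trans u2 (le_trans yB _); rewrite lerDl.
      have [b1 b2] := winxy z z1 z2; have [b3 b4] := winxy w w1 w2.
      have -> : V y - V x = (M y - M x) + (N y - N x) by rewrite /V; ring.
      apply: Posc => //.
      by apply: lerD; [apply: Mosc|apply: Nosc]; apply/andP.
    rewrite ger0_norm ?subr_ge0 ?Mh' // /V.
    by have := Nh xy; rewrite /N; lra.
  have AB : A <= B by lra.
  have le1 : H A <= H B.
    apply: (@quadratic_increment_homo _ H V C A B Vc Vh AB) => x y Ax xy yB.
    by have := incr x y Ax xy yB; rewrite ler_norml mulNr => /andP[].
  have le2 : - H A <= - H B.
    apply: (@quadratic_increment_homo _ (fun x => - H x) V C A B Vc Vh AB) => x y Ax xy yB.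
    by have := incr x y Ax xy yB; rewrite ler_norml mulNr => /andP[]; lra.
  have HAB : H A = H B by lra.
  rewrite -/(H x0) -/(H (phi x0)); move: HAB; rewrite /A /B.
  by case: (leP x0 (phi x0)).
pose D x := area_form (g (M x)) (g (N x)) - S x + S (phi x).
have Dper : D (x0 + 1) = D x0.
  have -> : D (x0 + 1) = area_form (g (M x0)) (g (N x0)) - S (x0 + 1) + S (phi x0 + 1).
    by rewrite /D /N phiper !Mper !(curve_periodic gP).
  by rewrite /D; lra.
(* Here [k] is a lower bound for [act]: it will be [c] on [[x0, y0]] and 0 on the rest of the
   period. *)
have incr k x y : x0 <= x -> x <= y -> y <= x0 + 1 -> (forall z, x <= z <= y ->
    k <= act g dg (M z) (M (phi z)) (M (phi (phi z)))) ->
    - C * (V y - V x) ^+ 2 <= (D y - k * N y) - (D x - k * N x).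
  move=> xx xy yy kact.
  have Ax : A <= x by lra.
  have yB : y <= B + 1 by lra.
  have dM : 0 <= M y - M x by rewrite subr_ge0 Mh'.
  have dN : 0 <= N y - N x by rewrite subr_ge0 Nh.
  have [xi /andP[xi1 xi2] e1] := mvt_le (area_form_curve_derive gP (g (N y))) (Mh' xy).
  have [eta /andP[eta1 eta2] e2] := mvt_le (area_form_curve_derive gP (g (M x))) (Nh xy).
  have [z zxy e3] := SP x y Ax xy.
  have [w' /andP[w1 w2] e4] := SP (phi x) (phi y) ltac:(have := phi_le xx; lra) (phi_le xy).
  have [w ew] := phi_surj w'; rewrite -ew in w1 w2 e4.
  have wx : x <= w by rewrite leNgt; apply/negP => /phi_lt; rewrite ltNge w1.
  have wy : w <= y by rewrite leNgt; apply/negP => /phi_lt; rewrite ltNge w2.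
  have wxy : x <= w <= y by rewrite wx.
  have actw := kact w wxy.
  have winxy u : x <= u <= y -> lo <= M u <= hi /\ lo <= N u <= hi.
    by case/andP=> u1 u2; apply: win; [exact: le_trans u1|exact: le_trans yB].
  have xx' : x <= x <= y by rewrite lexx xy.
  have yy' : x <= y <= y by rewrite lexx xy.
  have [bx1 bx2] := winxy x xx'; have [by1 by2] := winxy y yy'.
  have [bz1 bz2] := winxy z zxy; have [bw1 bw2] := winxy w wxy.
  have dV : V y - V x = (M y - M x) + (N y - N x) by rewrite /V; ring.
  have q1 : `|area_form (dg xi) (g (N y)) - p z| <= C * (V y - V x).
    rewrite dV; apply: Posc => //; first last.
      by case/andP: bx1 by1 => [l1 _] /andP[_ l2]; rewrite (le_trans l1 xi1) (le_trans xi2 l2).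
    apply: lerD; last exact: Nosc.
    by apply: (osc id) => //; case/andP: zxy => /Mh' ? /Mh' ?; apply/andP.
  have q2 : `|area_form (dg (N w)) (g (M w)) - area_form (dg eta) (g (M x))|
      <= C * (V y - V x).
    rewrite dV (addrC (M y - M x)); apply: Posc => //; first last.
      by case/andP: bx2 by2 => [l1 _] /andP[_ l2]; rewrite (le_trans l1 eta1) (le_trans eta2 l2).
    apply: lerD; last exact: Mosc.
    by apply: (osc id) => //; apply/andP; split; rewrite // /N; apply: Nh.
  (* The [M]-terms cancel up to the displacement from [z] to [xi]; the [N]-terms assemble into [act]
     at [w] up to the displacement of their mean value points. *)
  have -> : D y - k * N y - (D x - k * N x) =
    (area_form (dg xi) (g (N y)) - p z) * (M y - M x) +
    ((act g dg (M w) (M (phi w)) (M (phi (phi w))) - k) +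
     (area_form (dg (N w)) (g (M w)) - area_form (dg eta) (g (M x)))) * (N y - N x).
    rewrite /act area_formBr.
    have -> : area_form (dg (M (phi w))) (g (M (phi (phi w)))) = p (phi w) by [].
    have D1 : D y - D x = - (area_form (g (N y)) (g (M y)) - area_form (g (N y)) (g (M x)))
      + (area_form (g (M x)) (g (N y)) - area_form (g (M x)) (g (N x)))
      - (S y - S x) + (S (phi y) - S (phi x)).
      rewrite /D (area_formC (g (N y)) (g (M y))) (area_formC (g (N y)) (g (M x))).
      by ring.
    rewrite e1 e2 e3 e4 -/(N x) -/(N y) -/(N w) in D1 *.
    rewrite (area_formC (dg xi)) (area_formC (dg eta)).
    have -> : D y - k * N y - (D x - k * N x) = (D y - D x) - k * (N y - N x) by ring.
    by rewrite D1; ring.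
  move: q1 q2; rewrite !ler_norml => /andP[q1 _] /andP[q2 _].
  move: q1 q2 actw; set T1 := _ - p z; set T2 := _ - area_form (dg eta) _.
  set a0 := act _ _ _ _ _; rewrite dV => q1 q2 actw.
  have h1 : 0 <= (T1 + C * (M y - M x + (N y - N x))) * (M y - M x).
    by apply: mulr_ge0 => //; rewrite -lerBlDr sub0r.
  have h2 : 0 <= (a0 - k + T2 + C * (M y - M x + (N y - N x))) * (N y - N x).
    by apply: mulr_ge0 => //; rewrite -addrA addr_ge0 ?subr_ge0 // -lerBlDr sub0r.
  move: h1 h2; clear actw q1 q2; move: (M y - M x) (N y - N x) => u v.
  by move: T1 T2 a0 => T1 T2 a0 h1 h2; lra.
(* [D] gains at least [c * (N y0 - N x0)] on [[x0, y0]], loses nothing on the rest of the period,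
   and must return to its initial value. *)
have h1 := @quadratic_increment_homo _ (fun x => D x - c * N x) V C x0 y0 Vc Vh xy0.
have h2 := @quadratic_increment_homo _ (fun x => D x - 0 * N x) V C y0 (x0 + 1) Vc Vh yx0.
have {}h1 : D x0 - c * N x0 <= D y0 - c * N y0.
  apply: h1 => x y xx xy yy; apply: incr => //; first lra.
  by move=> z /andP[z1 z2]; apply: actc; apply/andP; split; lra.
have {}h2 : D y0 - 0 * N y0 <= D (x0 + 1) - 0 * N (x0 + 1).
  apply: h2 => x y xx xy yy; apply: incr => //; first lra.
  by move=> z _; exact: max_subsolution.
have : c * (N y0 - N x0) <= 0 by rewrite Dper in h2; lra.
by rewrite pmulr_rle0 // subr_le0.
Qed.

Lemma max_lt x y : x < y -> M x < M y.
Proof.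
move=> xy; rewrite lt_neqAle Mh' ?ltW // andbT; apply/negP => /eqP Mxy.
pose P := [set z | M z <= M x].
have Psup : has_sup P.
  split; first by exists x; rewrite /P /=.
  have [u Mu] := quasi_periodic_surj Mc d0 Mper (M x + 1).
  exists u => z; rewrite /P /= => zx; rewrite leNgt; apply/negP => /ltW /Mh'; lra.
(* The right end of the plateau through [x] and [y]. *)
pose q := sup P.
have yq : y <= q by apply: ub_le_sup; [exact: Psup.2|rewrite /P /= Mxy].
have qgt z : q < z -> M x < M z.
  move=> qz; rewrite ltNge; apply/negP => zx.
  have : z <= q by apply: ub_le_sup; [exact: Psup.2|].
  by rewrite leNgt qz.
have Mq : M q = M x.
  have xq : x <= q by apply: le_trans yq; exact: ltW.
  apply/eqP; rewrite eq_le (Mh' xq) andbT.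
  rewrite leNgt; apply/negP => h.
  have [e e0 eP] := (continuous_distP M q).1 (@Mc q) (M q - M x) ltac:(lra).
  have [z Pz zq] := sup_adherent e0 Psup.
  have zq' : z <= q by apply: ub_le_sup; [exact: Psup.2|].
  have /eP : `|z - q| < e.
    by rewrite ltr_norml; apply/andP; split; rewrite /q in zq' *; lra.
  by rewrite ltr_norml; move: Pz; rewrite /P /=; lra.
(* Otherwise [a] would stay below [M q] near [q], and [M] could not grow just after [q]. *)
have aq : a q = M q.
  apply/eqP; rewrite eq_le (Mub (lexx q)) leNgt /=; apply/negP => h.
  have [e e0 eP] := (continuous_distP a q).1 (@ac q) (M q - a q) ltac:(lra).
  have [z zq ez] := Matt (q + e / 2).
  have Mz : M q < a z by rewrite ez Mq; apply: qgt; lra.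
  have qz : q < z by rewrite ltNge; apply/negP => /Mub; lra.
  by have := eP z; rewrite !ltr_norml => /(_ ltac:(lra)); lra.
(* The plateau value is taken by [a] at [s] and again at [q], with [s < q]; [r] and [t] are their
   preimages under [phi]. *)
have [s sx es] := Matt x.
have [t et] := phi_surj q; have [r er] := phi_surj s.
have rt : r < t.
  rewrite ltNge; apply/negP => /phi_le; lra.
have ea : a (phi r) = a (phi t) by rewrite er et aq es.
have ar : a (phi r) = M (phi t) by rewrite ea et.
(* Failing this, neither [a (phi s)] nor [a (phi q)] lies below the maximum, so they agree; with
   [a s = a q] this contradicts [inv_inj]. *)
have pos : 0 < act g dg (M t) (M (phi t)) (M (phi (phi t))).
  have [_ pr] := max_act_ge0 (ltW rt) ar.
  have [_ pt] := max_act_ge0 (lexx t) (etrans (esym ea) ar).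
  have [/pt//|tM] := ltP (a (phi (phi t))) (M (phi (phi t))).
  have [/pr//|rM] := ltP (a (phi (phi r))) (M (phi (phi t))).
  have rM' : a (phi (phi r)) <= M (phi (phi t)).
    by apply: Mub; do 2!apply: phi_le; exact: ltW.
  have tM' : a (phi (phi t)) <= M (phi (phi t)) by exact: Mub.
  have e2 : a (phi (phi r)) = a (phi (phi t)) by lra.
  by have := inv_inj aP ea e2; rewrite er et; lra.
have actc : continuous (fun x => act g dg (M x) (M (phi x)) (M (phi (phi x)))).
  have -> : (fun x => act g dg (M x) (M (phi x)) (M (phi (phi x)))) =
    (fun x => area_form (dg (M (phi x))) (g (M (phi (phi x)))) -
              area_form (dg (M (phi x))) (g (M x))).
    by apply/funext => z; rewrite /act area_formBr.
  move=> z; apply: cvgB.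
    apply: (action_continuous Nc) => w.
    exact: (continuous_comp (@phic w) (@Nc (phi w))).
  exact: (action_continuous Nc Mc).
have [e e0 eP] := (continuous_distP _ t).1 (@actc t) _ (divr_gt0 pos (ltr0n _ 2)).
move: eP; set A := act _ _ _ _ _ in pos *; move=> eP.
pose h := Num.min (e / 2) 1.
have he : h <= e / 2 by rewrite ge_min lexx.
have h1 : h <= 1 by rewrite ge_min lexx orbT.
have h0 : 0 < h by rewrite lt_min; lra.
have Ac z : t <= z <= t + h ->
    A / 2 <= act g dg (M z) (M (phi z)) (M (phi (phi z))).
  move=> /andP[tz zh].
  have /eP : `|z - t| < e by rewrite ltr_norml; apply/andP; split; lra.
  by rewrite ltr_norml => /andP[]; lra.
(* [act] is bounded below just after [t], so [M \o phi] cannot grow there, although [M] grows just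
   after [q = phi t]. *)
have := @max_no_growth (A / 2) t (t + h) ltac:(lra) ltac:(lra) ltac:(lra) Ac.
by rewrite et Mq leNgt qgt // -et phi_lt //; lra.
Qed.

End Maximum.

(** Were the maximum up to [z] attained at some [w < z], then [M z = a w <= M w], against [max_lt].
    Hence [a = M]. *)
Lemma orbit_param_lt x y : x < y -> a x < a y.
Proof.
have [M [Mub Matt]] := running_max ac d0 aper.
have aM z : a z = M z.
  have [w wz e] := Matt z.
  move: wz; rewrite le_eqVlt => /orP[/eqP wz|wz]; first by rewrite -e wz.
  have := max_lt Mub Matt wz; have := Mub w w (lexx w); lra.
by rewrite !aM; exact: max_lt.
Qed.

End Core.

(** * Flat points *)

Section Flat.
Variables (R : realType) (g dg ddg : R -> R * R).
Hypothesis gP : oval g dg ddg.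

Lemma continuous_dist2 (f : R * R -> R) (x y : R) : {for (x, y), continuous f} ->
  forall e, 0 < e -> exists2 d, 0 < d & forall x' y', `|x' - x| < d ->
    `|y' - y| < d -> `|f (x', y') - f (x, y)| < e.
Proof.
move=> fc e e0; have /cvgrPdist_lt /(_ e e0) := fc => /nbhs_ballP[d /= d0 dH].
exists d => // x' y' xx yy; rewrite distrC; apply: (dH (x', y')).
by split; rewrite /ball /= distrC.
Qed.

Lemma tangent_pair_continuous : continuous (fun p : R * R => area_form (dg p.1) (dg p.2)).
Proof.
move=> p; rewrite /area_form; have [h1 h2] := tangent_continuous gP.
apply: cvgB; apply: cvgM.
- exact: (continuous_comp (@fst_continuous R R p) (@h1 p.1)).
- exact: (continuous_comp (@snd_continuous R R p) (@h2 p.2)).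
- exact: (continuous_comp (@fst_continuous R R p) (@h2 p.1)).
- exact: (continuous_comp (@snd_continuous R R p) (@h1 p.2)).
Qed.

Lemma acceleration_continuous v : continuous (fun z => area_form v (ddg z)).
Proof.
move=> z; rewrite /area_form; have [h1 h2] := oval_acceleration_continuous gP.
by apply: cvgB; apply: cvgM; [exact: cvg_cst|exact: h2|exact: cvg_cst|exact: h1].
Qed.

Variables (a phi : R -> R) (d j : int).
Hypotheses (aP : invariant_orbits g dg a phi d j) (d_gt0 : (0 < d)%R).

Lemma inv_tangents x : 0 < area_form (dg (a x)) (dg (a (phi x))).
Proof.
have [_ _] := inv_chord aP x.
by rewrite -mulrNz (tangent_periodic gP).
Qed.

(* Mather's argument: with s, t, u, v consecutive on an orbit of the curve, the
   equation act s t u = 0 gives du = o(dt) at a flat t, since the direction of the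
   tangent is stationary there, while act t u v = 0 gives dt = O(du). *)
Lemma no_flat_point t0 : area_form (dg t0) (ddg t0) <> 0.
Proof.
move=> flat.
have ac := inv_continuous aP; have phic := inv_map_continuous aP.
have alt := orbit_param_lt gP aP d_gt0; have phi_lt := inv_map_lt aP.
have d0 : 0 < d%:~R :> R by rewrite ltr0z.
have [y ey] := quasi_periodic_surj ac d0 (inv_periodic aP) t0.
have [x0 ex0] := quasi_periodic_surj phic ltr01 (inv_map_periodic aP) y.
rewrite -{}ex0 in ey.
set s0 := a x0; set u0 := a (phi (phi x0)); set v0 := a (phi (phi (phi x0))).
have act1 : act g dg s0 t0 u0 = 0 by rewrite -ey; exact: inv_act aP _.
have act2 : act g dg t0 u0 v0 = 0 by rewrite -ey; exact: inv_act aP _.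
have [c1a c1b c1c] : chord dg s0 (t0 - j%:~R) by rewrite -ey; exact: inv_chord aP _.
have [c2a c2b c2c] : chord dg u0 (v0 - j%:~R) by exact: inv_chord aP _.
have pos : 0 < area_form (dg t0) (dg u0) by rewrite -ey; exact: inv_tangents.
set c := area_form _ _ in pos; pose c' := c / 2.
have c'0 : 0 < c' by rewrite /c'; lra.
have [e1 e10 E1] := continuous_dist2 (@tangent_pair_continuous (t0, u0)) c'0.
(* The chord [g u0 - g s0] is [k] times the tangent at [t0], so turning the tangent changes [act]
   only through the area form with [dg t0]. *)
have [k kE] := area_form_parallel (tangent_neq0 gP t0) act1.
have [K K0 KP] := @bounded_segment _ (fun z => area_form (g v0 - g t0) (ddg z)) u0 (u0 + 1)
   (@acceleration_continuous (g v0 - g t0)).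
(* Chosen so that the ratios [|k| * eps / c'] of [step1] and [K / c'] of [step2] have product less
   than 1. *)
pose eps := c' ^+ 2 / (1 + K * `|k|).
have den : 0 < 1 + K * `|k| by apply: ltr_pwDl => //; exact: mulr_ge0.
have eps0 : 0 < eps by rewrite divr_gt0 // exprn_gt0.
have [e2 e20 E2] := (continuous_distP (fun z => area_form (dg t0) (ddg z)) t0).1
  (@acceleration_continuous (dg t0) t0) eps eps0.
have [e3 e30 E3] := (continuous_distP _ (t0 - j%:~R)).1
  (@area_form_tangent_continuous _ _ _ _ gP (dg s0) (t0 - j%:~R)) _ c1c.
(* [e1] keeps tangents transverse, [e2] bounds the turning at the flat point, [e3] and the next
   bound keep [s0] to [t - j] a chord, and the last two keep [u] before [v0 - j] and inside the
   range of [K]. *)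
have [e [e0 [ee1 [ee2 [ee3 [ee4 [ee5 ee6]]]]]]] : exists e : R,
   0 < e /\ e <= e1 /\ e <= e2 /\ e <= e3 /\
   e <= s0 + 1 - (t0 - j%:~R) /\ e <= v0 - j%:~R - u0 /\ e <= 1.
  pose m := Num.min e1 (Num.min e2 (Num.min e3 (Num.min (s0 + 1 - (t0 - j%:~R))
    (Num.min (v0 - j%:~R - u0) 1)))).
  by exists m; rewrite /m !lt_min !ge_min !lexx !orbT e10 e20 e30 !subr_gt0 c1b c2a ltr01.
have [d1 d10 D1] := (continuous_distP (a \o phi) x0).1
  (continuous_comp (@phic x0) (@ac (phi x0))) e e0.
have [d2 d20 D2] := (continuous_distP (a \o phi \o phi) x0).1
  (continuous_comp (@phic x0) (continuous_comp (@phic (phi x0)) (@ac (phi (phi x0))))) e e0.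
pose x := x0 + Num.min d1 d2 / 2.
have m1 : Num.min d1 d2 <= d1 by rewrite ge_min lexx.
have m2 : Num.min d1 d2 <= d2 by rewrite ge_min lexx orbT.
have m0 : 0 < Num.min d1 d2 by rewrite lt_min d10.
have xx0 : x0 < x by rewrite /x; order_lra.
have near_x : `|x - x0| = Num.min d1 d2 / 2 by rewrite ger0_norm /x; order_lra.
have {}D1 := D1 x ltac:(order_lra); have {}D2 := D2 x ltac:(order_lra).
have s0s : s0 < a x by exact: alt.
have t0t : t0 < a (phi x) by rewrite -ey; apply: alt; exact: phi_lt.
have u0u : u0 < a (phi (phi x)) by apply/alt/phi_lt/phi_lt.
have v0v : v0 < a (phi (phi (phi x))) by apply/alt/phi_lt/phi_lt/phi_lt.
have A1 := inv_act aP x; have A2 := inv_act aP (phi x).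
have C1 := inv_chord aP x; have C2 := inv_chord aP (phi (phi x)).
move: D1 D2 s0s t0t u0u v0v A1 A2 C1 C2; rewrite /= ey -/u0.
set s := a x; set t := a (phi x); set u := a (phi (phi x)); set v := a (phi (phi (phi x))).
clearbody s0 u0 v0.
move: s t u v => s t u v D1 D2 ss tt uu vv A1 A2 C1 C2.
have Kk : 0 <= K * `|k| by exact: mulr_ge0.
move: D1 D2; rewrite !ltr_norml => /andP[_ D1] /andP[_ D2].
have near_t z : t0 <= z <= t -> `|z - t0| < e.
  by move=> /andP[z1 z2]; rewrite ger0_norm; order_lra.
have near_u z : u0 <= z <= u -> `|z - u0| < e.
  by move=> /andP[z1 z2]; rewrite ger0_norm; order_lra.
have E1' z w : t0 <= z <= t -> u0 <= w <= u -> c' <= area_form (dg z) (dg w).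
  move=> /near_t zt /near_u wu.
  have := E1 z w (lt_le_trans zt ee1) (lt_le_trans wu ee1).
  by rewrite ltr_norml /= -/c; rewrite /c'; lra.
have tt' : t0 <= t <= t by rewrite lexx ltW.
have uu' : u0 <= u <= u by rewrite lexx ltW.
(* Since [s0 < s], moving the first point back to [s0] makes [act] nonpositive. The part due to
   [u - u0] is at least [c' * (u - u0)]; the part due to the turning tangent is small by
   flatness. *)
have step1 : c' * (u - u0) <= `|k| * eps * (t - t0).
  have C0 : chord dg s0 (t - j%:~R).
    have [C11 C12 C13] := C1.
    split; [order_lra|order_lra|].
    have : `|t - j%:~R - (t0 - j%:~R)| < e3.
      by apply: lt_le_trans ee3; rewrite (_ : _ - _ = t - t0); [exact: near_t|ring].
    by move=> /E3; rewrite ltr_norml; lra.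
  have le0 : act g dg s0 t u <= 0.
    rewrite -A1 -(act_shift_tangent gP _ _ _ j) -(act_shift_tangent gP s _ _ j).
    by apply: (act_le_l gP _ C0); [exact: ltW|case: C1].
  have [w /andP[w1 w2] e'] := mvt (area_form_curve_derive gP (dg t)) uu.
  have cw : c' <= area_form (dg t) (dg w) by apply: E1' => //; rewrite !ltW.
  have [z /andP[z1 z2] e''] := mvt (area_form_tangent_derive gP (dg t0)) tt.
  have ez : `|area_form (dg t0) (ddg z)| < eps.
    have := E2 z; rewrite flat subr0; apply.
    by apply: lt_le_trans ee2; apply: near_t; rewrite !ltW.
  have actu : act g dg s0 t u = area_form (dg t) (dg w) * (u - u0)
     - k * (area_form (dg t0) (ddg z) * (t - t0)).
    rewrite -e' -e'' area_formvv subr0 -[k * _]area_formZl -kE (area_formC _ (dg t)).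
    by rewrite /act !area_formBr; ring.
  have h1 : c' * (u - u0) <= area_form (dg t) (dg w) * (u - u0).
    by apply: ler_wpM2r => //; rewrite subr_ge0 ltW.
  have h2 : k * (area_form (dg t0) (ddg z) * (t - t0)) <= `|k| * eps * (t - t0).
    apply: le_trans (ler_norm _) _; rewrite !normrM mulrA (gtr0_norm (x := t - t0)) ?subr_gt0 //.
    by apply: ler_wpM2r; [rewrite subr_ge0 ltW|apply: ler_wpM2l => //; exact: ltW].
  by rewrite actu in le0; lra.
(* Symmetrically, the last point is moved back to [v0]; now the tangent at [u] turns by at most a
   multiple of [u - u0]. *)
have step2 : c' * (t - t0) <= K * (u - u0).
  have C3 : act g dg t u v0 <= 0.
    rewrite -A2 -(act_shift_end gP _ _ v0 j) -(act_shift_end gP _ _ v j).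
    by apply: (act_le_r gP _ C2); lra.
  have [z /andP[z1 z2] e'] := mvt (area_form_curve_derive gP (dg u)) tt.
  have cz : c' <= area_form (dg z) (dg u) by apply: E1' => //; rewrite !ltW.
  have [w /andP[w1 w2] e''] := mvt (area_form_tangent_derive gP (g v0 - g t0)) uu.
  have Kw : `|area_form (g v0 - g t0) (ddg w)| <= K by apply: KP; lra.
  have actt : act g dg t u v0 = area_form (dg z) (dg u) * (t - t0)
     - area_form (g v0 - g t0) (ddg w) * (u - u0).
    rewrite -e'' (area_formC (dg z)) mulNr -e'.
    rewrite !(area_formC (g v0 - g t0)) -/(act g dg t0 u0 v0) act2 oppr0 subr0 opprK.
    by rewrite /act !area_formBr; ring.
  have h1 : c' * (t - t0) <= area_form (dg z) (dg u) * (t - t0).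
    by apply: ler_wpM2r => //; rewrite subr_ge0 ltW.
  have h2 : area_form (g v0 - g t0) (ddg w) * (u - u0) <= K * (u - u0).
    by apply: ler_wpM2r; [rewrite subr_ge0 ltW|apply: le_trans (ler_norm _) _].
  by rewrite actt in C3; lra.
have epsE : eps * (1 + K * `|k|) = c' ^+ 2 by rewrite /eps divfK // gt_eqF.
have s1 := ler_wpM2l K0 step1; have s2 := ler_wpM2l (ltW c'0) step2.
have tt0 : 0 < eps * (t - t0) by rewrite mulr_gt0 // subr_gt0.
have : c' ^+ 2 * (t - t0) <= K * `|k| * (eps * (t - t0)).
  by move: s1 s2; rewrite expr2; lra.
by rewrite -epsE; lra.
Qed.

End Flat.

(** * Lifting *)

Lemma periodic_int (R : realType) (T : Type) (f : R -> T) :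
  (forall x, f (x + 1) = f x) -> forall x (k : int), f (x + k%:~R) = f x.
Proof.
move=> fp.
have nat x (n : nat) : f (x + n%:R) = f x.
  by elim: n => [|n IH]; rewrite ?addr0 // -natr1 addrA fp.
move=> x [n|n]; first exact: nat.
by rewrite NegzE mulrNz -(nat _ n.+1) subrK.
Qed.

Lemma min_lipschitz (R : realType) (c x y : R) :
  `|Num.min x c - Num.min y c| <= `|x - y|.
Proof.
case: (leP x c) => xc; case: (leP y c) => yc; rewrite ?subrr //;
  by rewrite ler_norml; case: (ger0P (x - y)) => ?; lra.
Qed.

Lemma max_lipschitz (R : realType) (c x y : R) :
  `|Num.max c x - Num.max c y| <= `|x - y|.
Proof.
case: (leP c x) => xc; case: (leP c y) => yc; rewrite ?subrr //;
  by rewrite ler_norml; case: (ger0P (x - y)) => ?; lra.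
Qed.

Lemma min_cst_continuous (R : realType) (c : R) : continuous (fun x => Num.min x c).
Proof.
move=> x; apply/continuous_distP => e e0; exists e => // y; apply: le_lt_trans.
exact: min_lipschitz.
Qed.

Lemma max_cst_continuous (R : realType) (c : R) : continuous (fun x => Num.max c x).
Proof.
move=> x; apply/continuous_distP => e e0; exists e => // y; apply: le_lt_trans.
exact: max_lipschitz.
Qed.

Section PeriodicExtension.
Variables (R : realType) (E : normedModType R).

Lemma within_continuous_dist (f : R -> E) (a b : R) : {within `[a, b], continuous f} ->
  forall x, a <= x <= b -> forall e, 0 < e -> exists2 d, 0 < d &
    forall y, a <= y <= b -> `|y - x| < d -> `|f y - f x| < e.
Proof.
move=> /subspace_continuousP fc x xab e e0.
have xI : `[a, b]%classic x by rewrite /= in_itv.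
have /cvgrPdist_lt /(_ e e0) := fc x xI.
rewrite near_withinE => /nbhs_ballP[d /= d0 dH].
exists d => // y yab yx; rewrite distrC; apply: dH; last by rewrite /= in_itv.
by rewrite /ball /= distrC.
Qed.

Lemma floor_unique (x : R) (n : int) : n%:~R <= x -> x < n%:~R + 1 -> Num.floor x = n.
Proof. by move=> h1 h2; apply: floor_def; rewrite h1 intrD. Qed.

Lemma frac_itv (x : R) : 0 <= x - (Num.floor x)%:~R < 1.
Proof. by have := floor_itv x; rewrite intrD; lra. Qed.

Lemma periodic_extension (f : R -> E) : {within `[0, 1], continuous f} ->
  f 0 = f 1 -> continuous (fun x : R => f (x - (Num.floor x)%:~R)).
Proof.
move=> fc f01 x; apply/continuous_distP => e e0.
set n := Num.floor x; have /andP[r0 r1] := frac_itv x; rewrite -/n in r0 r1.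
have [d d0 dP] := @within_continuous_dist f 0 1 fc (x - n%:~R) ltac:(lra) e e0.
move: r0; rewrite le_eqVlt => /orP[/eqP r0|r0].
  (* At an integer, points on the left have fractional part near 1, so continuity of [f] at 1
     enters. *)
  have [d1 d10 d1P] := @within_continuous_dist f 0 1 fc 1 ltac:(lra) e e0.
  have [m [m0 [md [md1 m1]]]] : exists m, 0 < m /\ m <= d /\ m <= d1 /\ m <= 1.
    exists (Num.min d (Num.min d1 1)).
    by rewrite !lt_min !ge_min !lexx !orbT d0 d10 ltr01.
  exists m => // y; rewrite ltr_norml => /andP[y1 y2].
  have [xy|yx] := leP x y.
    rewrite (@floor_unique y n); [|lra|lra].
    by apply: dP; [lra|rewrite ltr_norml; lra].
  rewrite (@floor_unique y (n - 1)); rewrite ?intrD; [|lra|lra].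
  rewrite -r0 f01; apply: d1P; first lra.
  by rewrite ltr_norml; lra.
have [m [m0 [md [mr m1]]]] : exists m, 0 < m /\ m <= d /\ m <= x - n%:~R /\
    m <= n%:~R + 1 - x.
  exists (Num.min d (Num.min (x - n%:~R) (n%:~R + 1 - x))).
  rewrite !lt_min !ge_min !lexx !orbT d0 r0 /=; split=> //; lra.
exists m => // y; rewrite ltr_norml => /andP[y1 y2].
rewrite (@floor_unique y n); [|lra|lra].
by apply: dP; [lra|rewrite ltr_norml; lra].
Qed.

End PeriodicExtension.

(** Real induction: a property that propagates to the right near every point reaches past its
    supremum. *)
Lemma segment_induction (R : realType) (P : R -> Prop) :
  (forall t, 0 <= t <= 1 -> exists2 d, 0 < d & forall x y, `|x - t| < d ->
    `|y - t| < d -> 0 <= x -> x <= y -> y <= 1 -> P x -> P y) ->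
  P 0 -> P 1.
Proof.
move=> step P0; pose T := [set t : R | 0 <= t <= 1 /\ P t].
have Tsup : has_sup T.
  by split; [exists 0; rewrite /T /= lexx ler01|exists 1 => x [/andP[]]].
have t0 : 0 <= sup T.
  by apply: ub_le_sup; [exact: Tsup.2|rewrite /T /= lexx ler01].
have t1 : sup T <= 1 by apply: ge_sup; [exact: Tsup.1|move=> x [/andP[]]].
have [d d0 dP] := step (sup T) ltac:(lra).
have [x [/andP[x0 x1] Px] xT] := sup_adherent d0 Tsup.
have xT' : x <= sup T.
  by apply: ub_le_sup; [exact: Tsup.2|rewrite /T /= x0 x1].
have nx : `|x - sup T| < d by rewrite ltr_norml; apply/andP; split; lra.
have [T1|T1] := ltP (sup T + d / 2) 1; last first.
  apply: (dP x 1) => //; rewrite ltr_norml; lra.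
have : T (sup T + d / 2).
  split; first lra.
  apply: (dP x) => //; [|lra|lra].
  by rewrite ltr_norml; lra.
by move=> /(ub_le_sup Tsup.2); lra.
Qed.

Section Lifting.
Variables (R : realType) (E : normedModType R) (p : R -> E).
Hypotheses (pc : continuous p)
  (p_eq : forall s t, p s = p t <-> exists k : int, s = t + k%:~R).

Let p_per s (k : int) : p (s + k%:~R) = p s.
Proof. by apply/p_eq; exists k. Qed.

(** By compactness the distance from [p s] to [p (s + r)] has a minimum over a period in [s] and [r]
    in [[eps, 1 - eps]]; injectivity modulo integers makes it positive. *)
Lemma loop_separation eps : 0 < eps -> eps < 1 / 2 -> exists2 delta, 0 < delta &
  forall s t, `|p s - p t| < delta -> exists k : int, `|s - t - k%:~R| < eps.
Proof.
move=> eps0 eps1.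
pose f (z : R * R) := `|p z.1 - p (z.1 + z.2)|.
have fc : continuous f.
  move=> z; apply: cvg_norm.
  apply: cvgB.
    exact: (continuous_comp (@fst_continuous R R z) (@pc z.1)).
  apply: (@continuous_comp _ _ _ (fun z : R * R => z.1 + z.2) p); last exact: pc.
  by apply: cvgD; [exact: fst_continuous|exact: snd_continuous].
pose K : set (R * R) := `[0, 1] `*` `[eps, 1 - eps].
have K0 : K !=set0.
  by exists (0, eps); rewrite /K /=; split; rewrite /= in_itv /=; lra.
have Kc : compact K by apply: compact_setX; exact: segment_compact.
have [c] := compact_EVT_min K0 Kc (continuous_subspaceT fc).
rewrite inE => -[/=]; rewrite !in_itv /= => c1 c2 cmin.
have fc0 : 0 < f c.
  rewrite /f normr_gt0 subr_eq0; apply/eqP => /p_eq[k ek].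
  have k0 : k = 0 by apply: (@int_squeeze R); lra.
  by rewrite k0 in ek; lra.
exists (f c) => // s t st.
have /andP[n1 n2] := frac_itv s; set n := Num.floor s in n1 n2.
have /andP[m1 m2] := frac_itv (t - s); set m := Num.floor _ in m1 m2.
have [r1|r1] := ltP (t - s - m%:~R) eps.
  by exists (- m); rewrite mulrNz ltr_norml; lra.
have [r2|r2] := ltP (1 - eps) (t - s - m%:~R).
  by exists (- m - 1); rewrite intrD !mulrNz ltr_norml; lra.
have : f c <= f (s - n%:~R, t - s - m%:~R).
  apply: cmin; rewrite inE /K /=; split; rewrite /= in_itv /=; lra.
rewrite /f /= -[- n%:~R]mulrNz p_per.
have -> : s + (- n)%:~R + (t - s - m%:~R) = t + (- n - m)%:~R.
  by rewrite intrD !mulrNz; ring.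
by rewrite p_per leNgt st.
Qed.

(** [D] measures the parameter displacement between nearby points of the loop without reference to a
    chosen parameter. Two candidates below 1/4 differ by an integer smaller than 1, so it is
    unique. *)
Lemma local_lift : exists2 delta, 0 < delta & exists D : E -> E -> R,
  forall r r', `|p r - p r'| < delta ->
    [/\ `|D (p r) (p r')| < 1 / 4, p (r + D (p r) (p r')) = p r' &
        `|r' - r| < 1 / 4 -> D (p r) (p r') = r' - r].
Proof.
have [delta d0 dP] := @loop_separation (1 / 4) ltac:(lra) ltac:(lra).
pose D (e e' : E) := xget 0 [set v | `|v| < 1 / 4 /\ exists2 r, p r = e & p (r + v) = e'].
exists delta => //; exists D => r r' rr.
have : [set v | `|v| < 1 / 4 /\
    exists2 r1, p r1 = p r & p (r1 + v) = p r'] (D (p r) (p r')).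
  have [k kr] := dP _ _ rr; apply: xgetPex; exists (r' + k%:~R - r); split.
    by rewrite -normrN opprB opprD addrA.
  by exists r => //; rewrite addrCA subrr addr0 p_per.
set v := D _ _ => -[v1 [r1 er1 er2]].
have erv : p (r + v) = p r'.
  have [k ek] := (p_eq _ _).1 er1.
  by rewrite -er2 ek addrAC p_per.
split => // rr1.
have [k ek] := (p_eq _ _).1 erv.
move: v1 rr1; rewrite !ltr_norml => v1 rr1.
have k0 : k = 0 by apply: (@int_squeeze R); lra.
by move: ek; rewrite k0; lra.
Qed.

Lemma lift_segment (q : R -> E) : continuous q -> (forall x, exists r, p r = q x) ->
  exists2 a : R -> R, continuous a & forall x, 0 <= x <= 1 -> p (a x) = q x.
Proof.
move=> qc qp; have [delta delta0 [D DP]] := local_lift.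
pose P t := exists2 a : R -> R, continuous a & forall x, 0 <= x <= t -> p (a x) = q x.
suff : P 1 by [].
apply: segment_induction; last first.
  have [r er] := qp 0; exists (cst r); first by move=> x; exact: cvg_cst.
  by move=> x x0; have -> : x = 0 by lra.
move=> t t01; have [d d0 dP] := (continuous_distP q t).1 (@qc t) (delta / 2) ltac:(lra).
exists d => // x y xt yt x0 xy y1 [a ac ap].
have near z : x <= z <= y -> `|q x - q z| < delta.
  move=> /andP[z1 z2]; have zt : `|z - t| < d.
    by move: xt yt; rewrite !ltr_norml; lra.
  have h1 := dP _ zt; have h2 := dP _ xt; rewrite -(subrKA (q t)).
  by apply: le_lt_trans (ler_normD _ _) _; rewrite (distrC (q t)); lra.
(* Clamping to [[x, y]] makes the extended lift continuous on the whole line: the old lift stopped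
   at [x], plus the displacement from [q x]. *)
pose cl z := Num.max x (Num.min z y).
have clxy z : x <= cl z <= y by rewrite /cl le_max lexx ge_max xy ge_min lexx orbT.
have clc : continuous cl.
  move=> z.
  exact: (continuous_comp (@min_cst_continuous R y z) (@max_cst_continuous R x _)).
pose mi z := Num.min z x.
have mic : continuous mi by exact: min_cst_continuous.
have ax : p (a x) = q x by apply: ap; rewrite x0 lexx.
exists (fun z => a (mi z) + D (q x) (q (cl z))).
  move=> z; apply: cvgD; first exact: (continuous_comp (@mic z) (@ac (mi z))).
  apply/continuous_distP => e e0.
  have [r er] := qp (cl z).
  have nr : `|p (a x) - p r| < delta by rewrite ax er; exact: near.
  have [v1 v2 _] := DP _ _ nr; rewrite ax er in v1 v2.
  set v := D _ _ in v1 v2 *.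
  (* The margin [1 / 4 - |v|] keeps the perturbed displacement below 1/4, where [D] is the true
     difference. *)
  pose eta := Num.min e (1 / 4 - `|v|).
  have eta0 : 0 < eta by rewrite lt_min; lra.
  have eta1 : eta <= e by rewrite ge_min lexx.
  have eta2 : eta <= 1 / 4 - `|v| by rewrite ge_min lexx orbT.
  have [dl dl0 dlP] := loop_separation eta0 ltac:(have := normr_ge0 v; lra).
  have [d' d'0 d'P] := (continuous_distP (q \o cl) z).1
    (continuous_comp (@clc z) (@qc (cl z))) dl dl0.
  exists d' => // w /d'P /= qw.
  have [r' er'] := qp (cl w).
  have [k kr] : exists k : int, `|r' - (a x + v) - k%:~R| < eta.
    by apply: dlP; rewrite er' v2.
  have erk : p (r' - k%:~R) = q (cl w) by rewrite -mulrNz p_per.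
  have nr' : `|p (a x) - p (r' - k%:~R)| < delta by rewrite ax erk; exact: near.
  have [_ _] := DP _ _ nr'; rewrite ax erk => ->.
    by apply: lt_le_trans eta1; rewrite (_ : _ - v = r' - (a x + v) - k%:~R) //; ring.
  have := ler_normD (r' - (a x + v) - k%:~R) v.
  have -> : r' - (a x + v) - k%:~R + v = r' - k%:~R - a x by ring.
  lra.
move=> z /andP[z0 zy].
have nz : `|p (a x) - q (cl z)| < delta by rewrite ax; exact: near.
have [r er] := qp (cl z); rewrite -er in nz.
have [v1 v2 v3] := DP _ _ nz; rewrite ax er in v1 v2 v3.
have [zx|xz] := leP z x.
  have clz : cl z = x by rewrite /cl (min_idPl zy) (max_idPl zx).
  rewrite clz in v3 v2 er *.
  have D0 : D (q x) (q x) = 0.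
    have [|_ _ h] := DP (a x) (a x); first by rewrite subrr normr0.
    by rewrite -ax h subrr // normr0; lra.
  by rewrite D0 addr0 /mi (min_idPl zx) ap // z0.
have -> : mi z = x by rewrite /mi (min_idPr (ltW xz)).
by rewrite v2 /cl (min_idPl zy) (max_idPr (ltW xz)).
Qed.

Lemma periodic_lift (q : R -> E) : continuous q -> (forall x, q (x + 1) = q x) ->
  (forall x, exists r, p r = q x) ->
  exists a : R -> R, exists d : int, [/\ continuous a, forall x, p (a x) = q x &
    forall x, a (x + 1) = a x + d%:~R].
Proof.
move=> qc qper qp; have [a ac ap] := lift_segment qc qp.
have [d ed] : exists d : int, a 1 = a 0 + d%:~R.
  apply/p_eq; rewrite !ap ?lexx ?ler01 //.
  by rewrite -[1]add0r qper.
(* Without its linear part the lift has equal values at 0 and 1 and extends periodically. *)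
pose b x := a x - d%:~R * x.
have bc : continuous b.
  move=> x; apply: cvgB; first exact: ac.
  by apply: cvgM; [exact: cvg_cst|exact: cvg_id].
have b01 : b 0 = b 1 by rewrite /b ed; ring.
have bpc := periodic_extension (continuous_subspaceT bc) b01.
exists (fun x => b (x - (Num.floor x)%:~R) + d%:~R * x), d.
have fl (x : R) : Num.floor (x + 1) = Num.floor x + 1.
  by have := floor_itv x; rewrite intrD => ?; apply: floor_unique; rewrite intrD; lra.
split => [x|x|x].
- by apply: cvgD; [exact: bpc|apply: cvgM; [exact: cvg_cst|exact: cvg_id]].
- rewrite /b.
  have -> : a (x - (Num.floor x)%:~R) - d%:~R * (x - (Num.floor x)%:~R) + d%:~R * x =
      a (x - (Num.floor x)%:~R) + (d * Num.floor x)%:~R by rewrite intrM; ring.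
  rewrite p_per ap; last by have := frac_itv x; lra.
  by rewrite -mulrNz (periodic_int qper).
- rewrite fl intrD opprD addrACA subrr addr0; ring.
Qed.

End Lifting.

(** * Invariant curves of the symplectic billiard *)

Section PhaseSpace.
Variables (R : realType) (g : R -> R * R).
Hypotheses (gc : smooth_closed_curve g) (gx : strictly_convex g)
  (go : positively_oriented g).

Let gP := curve_oval gc gx go.

Lemma euclidean_norm_gt0 (v : R * R) : v != 0 -> 0 < euclidean_norm v.
Proof.
case: v => x y /= v0; rewrite /euclidean_norm sqrtr_gt0 /=.
rewrite lt_neqAle addr_ge0 ?sqr_ge0 // andbT eq_sym paddr_eq0 ?sqr_ge0 //.
rewrite !sqrf_eq0; apply: contra v0 => /andP[/eqP -> /eqP ->]; exact: eqxx.
Qed.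

Lemma rotated_area (u v : R * R) : u != 0 -> v != 0 ->
  (0 < area_form ((euclidean_norm u)^-1 *: (u.2, - u.1))
                 ((euclidean_norm v)^-1 *: (v.2, - v.1))) = (0 < area_form u v).
Proof.
move=> /euclidean_norm_gt0 u0 /euclidean_norm_gt0 v0.
rewrite area_formZl area_formZr !pmulr_rgt0 ?invr_gt0 //; congr (0 < _).
by rewrite /area_form /=; ring.
Qed.

Lemma outer_normal_area s t :
  (0 < area_form (outer_normal g s) (outer_normal g t)) =
  (0 < area_form (derive1 g s) (derive1 g t)).
Proof. exact: rotated_area (tangent_neq0 gP s) (tangent_neq0 gP t). Qed.

Lemma phase_spaceE (z : (R * R) * (R * R)) : phase_space g z <->
  exists s t, z = (g s, g t) /\ 0 < area_form (derive1 g s) (derive1 g t).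
Proof.
by split=> -[s [t [-> h]]]; exists s, t; split => //; move: h; rewrite outer_normal_area.
Qed.

(** If no point were admissible, [xget] would return [g s]; by antisymmetry the pair [(g t, g s)] is
    outside the phase space, so the second hypothesis rules out the default value. *)
Lemma billiardE s t : 0 < area_form (derive1 g s) (derive1 g t) ->
  phase_space g (symplectic_billiard g (g s, g t)) ->
  exists u, [/\ symplectic_billiard g (g s, g t) = (g t, g u),
    0 < area_form (derive1 g t) (derive1 g u) & act g (derive1 g) s t u = 0].
Proof.
rewrite phase_spaceE /symplectic_billiard /parallel_to_tangent /=.
move: (derive1 g) (derive1n 2 g) gP => dg ddg gP' st; set Z := [set z | _].
case: xgetP => [z _ [[u _ uz] zs [t' tt' zpar]]|noz].
  move=> -[s1 [t1 [[e1 e2] h]]]; exists u; rewrite uz; split => //.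
    have [k1 ek1] := (curve_eq gP' _ _).1 e1.
    have e3 : g u = g t1 by rewrite uz.
    have [k2 ek2] := (curve_eq gP' _ _).1 e3.
    by rewrite ek1 ek2 !(tangent_periodic gP').
  have [k1 ek1] := (curve_eq gP' _ _).1 tt'.
  by rewrite /act uz -zpar ek1 (tangent_periodic gP').
move=> -[s1 [t1 [[e1 e2] h]]].
have [k1 ek1] := (curve_eq gP' _ _).1 e1; have [k2 ek2] := (curve_eq gP' _ _).1 e2.
move: h st; rewrite ek1 ek2 !(tangent_periodic gP') area_formC oppr_gt0 => h1 h2.
by have := lt_trans h1 h2; rewrite ltxx.
Qed.

End PhaseSpace.

Lemma pair_continuous (T U V : topologicalType) (f : T -> U) (h : T -> V) :
  continuous f -> continuous h -> continuous (fun x => (f x, h x)).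
Proof. by move=> fc hc x; exact: (cvg_pair (@fc x) (@hc x)). Qed.

Section IntegerValued.
Variable R : realType.

Lemma ivt_any (f : R -> R) x y v : continuous f -> f x <= v <= f y -> exists z, f z = v.
Proof.
move=> fc v1; have [xy|yx] := leP x y.
  by have [z _ <-] := ivt fc xy v1; exists z.
by have [z _ <-] := ivt_dec fc (ltW yx) v1; exists z.
Qed.

Lemma integer_valued_cst (f : R -> R) : continuous f ->
  (forall x, exists k : int, f x = k%:~R) -> exists k : int, forall x, f x = k%:~R.
Proof.
move=> fc fi; have lt_abs x y : ~ f x < f y.
  move=> xy; have [k ek] := fi x; have [l el] := fi y.
  have kl : (k + 1 <= l)%R.
    by move: xy; rewrite ek el ltr_int; lia.
  have kl' : k%:~R + 1 <= l%:~R :> R by rewrite -[1]/(1%:~R) -intrD ler_int.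
  have [|z ez] := @ivt_any f x y (f x + 1 / 2) fc; first by rewrite el ek; lra.
  have [m em] := fi z.
  have m1 : (k < m)%R by rewrite -(ltr_int R); lra.
  have m2 : (m < k + 1)%R by rewrite -(ltr_int R) intrD; lra.
  by lia.
have [k ek] := fi 0; exists k => x; rewrite -ek.
by case: (ltgtP (f x) (f 0)) => // /lt_abs.
Qed.

End IntegerValued.

Section Lifts.
Variables (R : realType) (g dg ddg : R -> R * R).
Hypothesis gP : oval g dg ddg.
Variable c : R -> (R * R) * (R * R).
Hypotheses (cc : {within `[0, 1], continuous c}) (c01 : c 0 = c 1)
  (c_inj : forall s t : R, 0 <= s < 1 -> 0 <= t < 1 -> c s = c t -> s = t)
  (c_phase : forall x, 0 <= x <= 1 -> exists s t,
     c x = (g s, g t) /\ 0 < area_form (dg s) (dg t))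
  (c_inv : forall x s t, 0 <= x <= 1 -> c x = (g s, g t) ->
     0 < area_form (dg s) (dg t) -> exists y u, [/\ 0 <= y <= 1,
     c y = (g t, g u), 0 < area_form (dg t) (dg u) & act g dg s t u = 0]).

(** An embedded circle: its components are lifted through [g], and later the billiard map is lifted
    through [C] itself. *)
Let C (x : R) := c (x - (Num.floor x)%:~R).

Let Cc : continuous C. Proof. exact: periodic_extension. Qed.

Let frac_id (x : R) : 0 <= x < 1 -> x - (Num.floor x)%:~R = x.
Proof. by move=> x01; rewrite (@floor_unique _ x 0) ?subr0 //; lra. Qed.

Let C_id x : 0 <= x <= 1 -> C x = c x.
Proof.
move=> x01; rewrite /C; have [x1|x1] := ltP x 1; first by rewrite frac_id //; lra.
have -> : x = 1 by lra.
by rewrite (@floor_unique _ 1 1) ?subrr //; lra.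
Qed.

Let C_eq s t : C s = C t <-> exists k : int, s = t + k%:~R.
Proof.
split=> [/c_inj h|[k ->]].
  have e := h (frac_itv s) (frac_itv t).
  by exists (Num.floor s - Num.floor t); rewrite intrD mulrNz; lra.
rewrite /C (@floor_unique _ (t + k%:~R) (Num.floor t + k)).
- by congr c; rewrite intrD; ring.
- by rewrite intrD; have := frac_itv t; lra.
- by rewrite intrD; have := frac_itv t; lra.
Qed.

Let C_phase x : exists s t, C x = (g s, g t) /\ 0 < area_form (dg s) (dg t).
Proof. by apply: c_phase; have := frac_itv x; lra. Qed.

Let area_curve_eq s t s' t' : g s = g s' -> g t = g t' ->
  area_form (dg s) (dg t) = area_form (dg s') (dg t').
Proof.
move=> /(curve_eq gP)[k ->] /(curve_eq gP)[l ->].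
by rewrite !(tangent_periodic gP).
Qed.

Let g_cont : continuous g.
Proof.
have [h1 h2] := curve_continuous gP.
have -> : g = (fun x => ((fst \o g) x, (snd \o g) x)).
  by apply/funext => y /=; case: (g y).
exact: pair_continuous.
Qed.

(** The difference of the two lifts is never an integer, since a tangent has zero area form with
    itself. An integer shift puts it in [(0, 1)] for all [x], which also makes the degrees equal. *)
Lemma curve_lift : exists a b : R -> R, exists d : int,
  [/\ continuous a, continuous b, forall x, C x = (g (a x), g (b x)) &
   [/\ forall x, chord dg (a x) (b x), forall x, a (x + 1) = a x + d%:~R &
      forall x, b (x + 1) = b x + d%:~R]].
Proof.
have C_per x : C (x + 1) = C x by apply/C_eq; exists 1.
have [a [d [ac ag aper]]] := @periodic_lift R _ g g_cont (curve_eq gP) (fst \o C)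
  (fun x => continuous_comp (@Cc x) (@fst_continuous _ _ (C x)))
  (fun x => congr1 fst (C_per x))
  (fun x => let: ex_intro s (ex_intro t (conj e _)) := C_phase x in
     ex_intro _ s (esym (congr1 fst e))).
have [b [d' [bc bg bper]]] := @periodic_lift R _ g g_cont (curve_eq gP) (snd \o C)
  (fun x => continuous_comp (@Cc x) (@snd_continuous _ _ (C x)))
  (fun x => congr1 snd (C_per x))
  (fun x => let: ex_intro s (ex_intro t (conj e _)) := C_phase x in
     ex_intro _ t (esym (congr1 snd e))).
have pos x : 0 < area_form (dg (a x)) (dg (b x)).
  have [s [t [e h]]] := C_phase x.
  by rewrite (@area_curve_eq _ _ s t) //; rewrite ?ag ?bg /= e.
have nint x (k : int) : b x - a x <> k%:~R.
  move=> e; have := pos x; have -> : b x = a x + k%:~R by lra.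
  by rewrite (tangent_periodic gP) area_formvv ltxx.
set m := Num.floor (b 0 - a 0).
pose w x := b x - a x - m%:~R.
have wc : continuous w.
  by move=> x; apply: cvgB; [apply: cvgB; [exact: bc|exact: ac]|exact: cvg_cst].
have w0 : 0 < w 0 < 1.
  have /andP[h1 h2] := frac_itv (b 0 - a 0); rewrite -/m -/(w 0) in h1 h2.
  rewrite h2 andbT lt_neqAle h1 andbT eq_sym; apply/eqP => e.
  by apply: (nint 0 m); move: e; rewrite /w; lra.
have w01 x : 0 < w x < 1.
  apply/andP; split; rewrite ltNge; apply/negP => h.
    have [|z ez] := @ivt_any R w x 0 0 wc; first lra.
    by apply: (nint z m); move: ez; rewrite /w; lra.
  have [|z ez] := @ivt_any R w 0 x 1 wc; first lra.
  by apply: (nint z (m + 1)); move: ez; rewrite /w intrD; lra.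
have dd : d' = d.
  have := w01 0; have := w01 (0 + 1).
  have -> : w (0 + 1) = w 0 + (d' - d)%:~R by rewrite /w aper bper intrD mulrNz; ring.
  move=> h1 h2; have : d' - d = 0 by apply: (@int_squeeze R); lra.
  lia.
exists a, (fun x => b x - m%:~R), d; split=> //; [|move=> x|split=> // x].
- by move=> x; apply: cvgB; [exact: bc|exact: cvg_cst].
- rewrite -mulrNz (curve_periodic gP) ag bg /=; by case: (C x).
- have := w01 x; rewrite /w => ?; split; [lra|lra|].
  by rewrite -mulrNz (tangent_periodic gP).
- by rewrite bper dd; ring.
Qed.

(** The homotopy runs in parameter space: first all chords are shortened to the least length [eps],
    then their starting points slide to [a 0]. *)
Lemma chord_null_homotopic (P : set ((R * R) * (R * R))) (a b : R -> R) :
  (forall s t, 0 < area_form (dg s) (dg t) -> P (g s, g t)) ->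
  continuous a -> continuous b -> (forall x, chord dg (a x) (b x)) ->
  a 0 = a 1 -> b 0 = b 1 ->
  (forall x, 0 <= x <= 1 -> c x = (g (a x), g (b x))) -> null_homotopic P c.
Proof.
move=> PP ac bc ch a01 b01 cE.
have wc : continuous (fun x => b x - a x) by move=> x; apply: cvgB; [exact: bc|exact: ac].
have [m _ mmin] := EVT_min ler01 (continuous_subspaceT wc).
set eps := b m - a m in mmin.
have eps0 : 0 < eps by rewrite subr_gt0; case: (ch m).
have epsb x : 0 <= x <= 1 -> a x + eps <= b x.
  by move=> x01; have := mmin x; rewrite in_itv /= => /(_ x01); lra.
pose h1 (z : R * R) := Num.min (2 * z.1) 1.
pose h2 (z : R * R) := Num.max 0 (2 * z.1 - 1).
pose sg z := a z.2 + h2 z * (a 0 - a z.2).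
pose ta z := sg z + (b z.2 - a z.2) + h1 z * (eps - (b z.2 - a z.2)).
have fst2 : continuous (fun z : R * R => 2 * z.1).
  by move=> z; apply: cvgM; [exact: cvg_cst|exact: fst_continuous].
have h1c : continuous h1.
  by move=> z; exact: (continuous_comp (@fst2 z) (@min_cst_continuous R 1 _)).
have h2c : continuous h2.
  move=> z; apply: (@continuous_comp _ _ _ (fun z : R * R => 2 * z.1 - 1)
    (fun x => Num.max 0 x)); last exact: max_cst_continuous.
  by apply: cvgB; [exact: fst2|exact: cvg_cst].
have a2 : continuous (fun z : R * R => a z.2).
  by move=> z; exact: (continuous_comp (@snd_continuous R R z) (@ac z.2)).
have b2 : continuous (fun z : R * R => b z.2).
  by move=> z; exact: (continuous_comp (@snd_continuous R R z) (@bc z.2)).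
have sgc : continuous sg.
  move=> z; apply: cvgD; first exact: a2.
  by apply: cvgM; [exact: h2c|apply: cvgB; [exact: cvg_cst|exact: a2]].
have tac : continuous ta.
  move=> z; apply: cvgD.
    by apply: cvgD; [exact: sgc|apply: cvgB; [exact: b2|exact: a2]].
  apply: cvgM; first exact: h1c.
  by apply: cvgB; [exact: cvg_cst|apply: cvgB; [exact: b2|exact: a2]].
have gsc : continuous (g \o sg).
  by move=> z; exact: (continuous_comp (@sgc z) (@g_cont (sg z))).
have gtc : continuous (g \o ta).
  by move=> z; exact: (continuous_comp (@tac z) (@g_cont (ta z))).
exists (fun z => (g (sg z), g (ta z))).
  by apply: continuous_subspaceT; exact: pair_continuous gsc gtc.
split.
- move=> s t; rewrite /= !in_itv /= => /andP[s0 s1] t01; apply: PP.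
  have bt := epsb t t01; have cht := ch t.
  suff [] : chord dg (sg (s, t)) (ta (s, t)) by [].
  have [s2|s2] := leP s (1 / 2).
    have e1 : h1 (s, t) = 2 * s by rewrite /h1 /=; case: leP => //; lra.
    have e2 : h2 (s, t) = 0 by rewrite /h2 /=; case: leP => //; lra.
    rewrite /ta /sg e1 e2 /= mul0r addr0.
    have k1 : 0 <= 2 * s * (b t - a t - eps) by apply: mulr_ge0; lra.
    have k2 : 0 <= (1 - 2 * s) * (b t - a t - eps) by apply: mulr_ge0; lra.
    by apply: (chord_sub gP cht) => //; lra.
  have e1 : h1 (s, t) = 1 by rewrite /h1 /=; case: leP => //; lra.
  have e2 : h2 (s, t) = 2 * s - 1 by rewrite /h2 /=; case: leP => //; lra.
  (* A sliding start point stays in the range of [a], hence begins a chord of the curve of length at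
     least [eps]. *)
  have [x x01 ex] : exists2 x, 0 <= x <= 1 & a x = sg (s, t).
    have /andP[t0 t1] := t01.
    rewrite /sg e2 /=; have [at0|at0] := leP (a 0) (a t).
      have k1 : 0 <= (2 * s - 1) * (a t - a 0) by apply: mulr_ge0; lra.
      have k2 : 0 <= (2 - 2 * s) * (a t - a 0) by apply: mulr_ge0; lra.
      have [|x /andP[x0 xt] <-] := ivt ac t0 (v := a t + (2 * s - 1) * (a 0 - a t)).
        by apply/andP; split; lra.
      by exists x => //; lra.
    have k1 : 0 <= (2 * s - 1) * (a 0 - a t) by apply: mulr_ge0; lra.
    have k2 : 0 <= (2 - 2 * s) * (a 0 - a t) by apply: mulr_ge0; lra.
    have [|x /andP[x0 xt] <-] := ivt_dec ac t0 (v := a t + (2 * s - 1) * (a 0 - a t)).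
      by apply/andP; split; lra.
    by exists x => //; lra.
  rewrite /ta -ex e1 mul1r.
  have -> : a x + (b (s, t).2 - a (s, t).2) + (eps - (b (s, t).2 - a (s, t).2)) = a x + eps.
    by ring.
  by apply: (chord_sub gP (ch x)) => //; [lra|exact: epsb].
- move=> s _; rewrite /ta /sg /h1 /h2 /=.
  by rewrite a01 b01.
- move=> t; rewrite /= in_itv /= => t01; rewrite cE // /ta /sg /h1 /h2 /=.
  rewrite mulr0 sub0r (min_idPl _) ?ler01 // (max_idPl _) ?lerN10 //.
  by rewrite !mul0r !addr0 addrC subrK.
- exists (g (a 0), g (a 0 + eps)) => t _; rewrite /ta /sg /h1 /h2 /=.
  have -> : Num.min (2 * 1) 1 = 1 :> R by apply/min_idPr; lra.
  have -> : Num.max 0 (2 * 1 - 1) = 1 :> R by rewrite (max_idPr _); lra.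
  by congr (g _, g _); ring.
Qed.

Let area_chord s t : chord dg s t -> 0 < area_form (dg s) (dg t).
Proof. by case. Qed.

Lemma act_inj_end s t u u' : chord dg t u -> chord dg t u' ->
  act g dg s t u = act g dg s t u' -> u = u'.
Proof.
move=> cu cu' e; case: (ltgtP u u') => // h.
  have [tu _ _] := cu.
  by have := act_lt_r gP s cu' h tu; rewrite e ltxx.
have [tu _ _] := cu'.
by have := act_lt_r gP s cu h tu; rewrite e ltxx.
Qed.

Lemma act_inj_start s s' t u : chord dg s t -> chord dg s' t ->
  act g dg s t u = act g dg s' t u -> s = s'.
Proof.
move=> cs cs' e; case: (ltgtP s s') => // h.
  have [st _ _] := cs'.
  by have := act_lt_l gP u cs h st; rewrite e ltxx.
have [st _ _] := cs.
by have := act_lt_l gP u cs' h st; rewrite e ltxx.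
Qed.

(** The signs of [act] at [u x - h] and [u x + h] persist for nearby base points; the root between
    them is [u y] by strict monotonicity. *)
Lemma next_point_continuous (a b u : R -> R) : continuous a -> continuous b ->
  (forall x, chord dg (b x) (u x)) -> (forall x, act g dg (a x) (b x) (u x) = 0) ->
  continuous u.
Proof.
move=> ac bc ch actu x; have [bu ub pos] := ch x.
have [e1 e10 E1] := (continuous_distP _ (u x)).1
  (@area_form_tangent_continuous _ _ _ _ gP (dg (b x)) (u x)) _ pos.
apply/cvgrPdist_lt => e e0.
have [h [h0 [he [he1 [hb1 hb2]]]]] : exists h : R, 0 < h /\ h < e /\ h < e1 /\
    h < u x - b x /\ h < b x + 1 - u x.
  pose m := Num.min e (Num.min e1 (Num.min (u x - b x) (b x + 1 - u x))).
  have m0 : 0 < m by rewrite !lt_min e0 e10 !subr_gt0 bu ub.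
  have : m <= e /\ m <= e1 /\ m <= u x - b x /\ m <= b x + 1 - u x.
    by rewrite /m !ge_min !lexx !orbT.
  by exists (m / 2); lra.
have pos' : 0 < area_form (dg (b x)) (dg (u x + h)).
  have /E1 : `|u x + h - u x| < e1 by rewrite addrAC subrr add0r gtr0_norm.
  by rewrite ltr_norml => /andP[h1 _]; lra.
have ch' : chord dg (b x) (u x + h) by split => //; lra.
have lo : act g dg (a x) (b x) (u x - h) < 0.
  by rewrite -(actu x); apply: (act_lt_r gP _ (ch x)); lra.
have hi : 0 < act g dg (a x) (b x) (u x + h).
  by rewrite -(actu x); apply: (act_lt_r gP _ ch'); lra.
have actc v : continuous (fun y => act g dg (a y) (b y) v).
  have -> : (fun y => act g dg (a y) (b y) v) =
    (fun y => area_form (dg (b y)) (g v) - area_form (dg (b y)) (g (a y))).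
    by apply/funext => y; rewrite /act area_formBr.
  move=> y; apply: cvgB; last exact: (action_continuous gP bc ac).
  by apply: (action_continuous gP bc (v := cst v)) => z; exact: cvg_cst.
have tanc : continuous (fun y => area_form (dg (b y)) (dg (u x + h))).
  move=> y; apply: (@continuous_comp _ _ _ b (fun z => area_form (dg z) (dg (u x + h)))).
    exact: bc.
  have -> : (fun z => area_form (dg z) (dg (u x + h))) =
      (fun z => - area_form (dg (u x + h)) (dg z)).
    by apply/funext => z; rewrite area_formC.
  by apply: cvgN; exact: (area_form_tangent_continuous gP).
near=> y.
have b1 : b y < u x - h.
  by near: y; apply: (cvgr_lt (b x)); [exact: bc|lra].
have b2 : u x + h - 1 < b y.
  by near: y; apply: (cvgr_gt (b x)); [exact: bc|lra].
have a1 : act g dg (a y) (b y) (u x - h) < 0.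
  by near: y; apply: (cvgr_lt _ (actc (u x - h) x)).
have a2 : 0 < act g dg (a y) (b y) (u x + h).
  by near: y; apply: (cvgr_gt _ (actc (u x + h) x)).
have t1 : 0 < area_form (dg (b y)) (dg (u x + h)).
  by near: y; apply: (cvgr_gt _ (tanc x)).
have chy : chord dg (b y) (u x + h) by split => //; lra.
have cv : continuous (fun v => act g dg (a y) (b y) v).
  move=> v; rewrite /act.
  have -> : (fun v => area_form (dg (b y)) (g v - g (a y))) =
     (fun v => area_form (dg (b y)) (g v) - area_form (dg (b y)) (g (a y))).
    by apply/funext => z; rewrite area_formBr.
  apply: cvgB; last exact: cvg_cst.
  exact: derive_cont (area_form_curve_derive gP _ v).
have [||v /andP[v1 v2] ev] := @ivt R _ (u x - h) (u x + h) 0 cv; first lra.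
  by rewrite !ltW.
have uv : u y = v.
  apply: (@act_inj_end (a y) (b y)) => //; last by rewrite actu ev.
  by apply: (chord_sub gP chy) => //; lra.
by rewrite uv ltr_norml; lra.
Unshelve. all: by end_near.
Qed.

(** A value [phi y <= phi x] with [x < y] would force [phi] to climb back to [phi x] somewhere
    beyond [y]. *)
Lemma circle_homeo_lt (phi : R -> R) : continuous phi ->
  (forall x, phi (x + 1) = phi x + 1) -> injective phi ->
  forall x y, x < y -> phi x < phi y.
Proof.
move=> phic phiper phi_inj x y xy; rewrite ltNge; apply/negP => yx.
set n := Num.bound (phi x - phi y).
have hn : phi x < phi y + n%:R.
  by rewrite -ltrBlDl; apply: archi_boundP; rewrite subr_ge0.
have e : phi (y + n%:R) = phi y + n%:R.
  have := quasi_periodic phiper y n%:Z.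
  by rewrite mul1r.
have [||z /andP[yz _] ez] := @ivt R phi y (y + n%:R) (phi x) phic.
- by rewrite lerDl.
- by rewrite e yx ltW.
by have := phi_inj _ _ ez; lra.
Qed.

Lemma curve_orbits (a b : R -> R) (d : int) : d != 0 ->
  continuous a -> continuous b -> (forall x, C x = (g (a x), g (b x))) ->
  (forall x, chord dg (a x) (b x)) -> (forall x, a (x + 1) = a x + d%:~R) ->
  (forall x, b (x + 1) = b x + d%:~R) ->
  exists phi j, invariant_orbits g dg a phi d j.
Proof.
move=> d0 ac bc Cab ch aper bper.
have /choice[u uP] : forall x, exists u, [/\ chord dg (b x) u,
    act g dg (a x) (b x) u = 0 & exists y, C y = (g (b x), g u)].
  move=> x; have x01 : 0 <= x - (Num.floor x)%:~R <= 1 by have := frac_itv x; lra.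
  have [y [u [y01 cy pos act0]]] := c_inv x01 (Cab x) (area_chord (ch x)).
  have /andP[u0 u1] := frac_itv (u - b x); set n := Num.floor _ in u0 u1.
  have un : g (u - n%:~R) = g u by rewrite -mulrNz (curve_periodic gP).
  have dun : dg (u - n%:~R) = dg u by rewrite -mulrNz (tangent_periodic gP).
  exists (u - n%:~R); split.
  - split; rewrite ?dun //; last by order_lra.
    rewrite lt_neqAle; apply/andP; split; last by order_lra.
    by apply/eqP => e; move: pos; rewrite -dun -e area_formvv ltxx.
  - by rewrite /act un.
  by exists y; rewrite C_id // un.
have uch x : chord dg (b x) (u x) by case: (uP x).
have uact x : act g dg (a x) (b x) (u x) = 0 by case: (uP x).
have uc : continuous u := next_point_continuous ac bc uch uact.
have uper x : u (x + 1) = u x + d%:~R.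
  suff : u (x + 1) - d%:~R = u x by lra.
  apply: (@act_inj_end (a x) (b x)) => //.
    have [h1 h2 h3] := uch (x + 1); rewrite bper in h1 h2 h3.
    split; [order_lra|order_lra|].
    by rewrite -mulrNz (tangent_periodic gP); rewrite (tangent_periodic gP) in h3.
  rewrite uact (act_shift_end gP) -(uact (x + 1)) aper bper /act.
  by rewrite !(tangent_periodic gP) !(curve_periodic gP).
pose q x := (g (b x), g (u x)).
have qc : continuous q.
  apply: pair_continuous => x.
    exact: (continuous_comp (@bc x) (@g_cont (b x))).
  exact: (continuous_comp (@uc x) (@g_cont (u x))).
have qper x : q (x + 1) = q x by rewrite /q bper uper !(curve_periodic gP).
have qC x : exists r, C r = q x by case: (uP x).
have [phi [k [phic phiq phiper]]] := periodic_lift Cc C_eq qc qper qC.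
have gphi x : g (a (phi x)) = g (b x) /\ g (b (phi x)) = g (u x).
  by have := phiq x; rewrite Cab => -[-> ->].
have [j ej] : exists j : int, forall x, a (phi x) - b x = j%:~R.
  apply: integer_valued_cst.
    move=> x; apply: cvgB; last exact: bc.
    exact: (continuous_comp (@phic x) (@ac (phi x))).
  move=> x; have [h _] := gphi x.
  have [k' ek'] := (curve_eq gP _ _).1 h.
  by exists k'; rewrite ek'; ring.
have aphi x : a (phi x) = b x + j%:~R by rewrite -(ej x); ring.
(* Degrees in [a \o phi = b + j] give [d * k = d]. *)
have k1 : k = 1.
  have h := quasi_periodic aper (phi 0) k.
  rewrite -phiper aphi bper aphi in h.
  have h2 : (d * k)%:~R = d%:~R :> R by rewrite intrM; lra.
  move/eqP: h2; rewrite eqr_int => /eqP h2.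
  by apply: (mulfI d0); rewrite h2 mulr1.
have inj x y : a x = a y -> a (phi x) = a (phi y) -> x = y.
  rewrite !aphi => e1 /addIr e2.
  have : C x = C y by rewrite !Cab e1 e2.
  move=> /C_eq[n en]; move: e1; rewrite en (quasi_periodic aper).
  rewrite -[RHS]addr0 => /addrI/eqP; rewrite -intrM intr_eq0 mulf_eq0 (negbTE d0) /=.
  by move=> /eqP->; rewrite addr0.
have acts x : act g dg (a x) (a (phi x)) (a (phi (phi x))) = 0.
  rewrite (aphi x) /act (tangent_periodic gP) (gphi (phi x)).1 (gphi x).2.
  exact: uact.
have chs x : chord dg (a x) (a (phi x) - j%:~R) by rewrite aphi addrK.
exists phi, j; split => //.
- by move=> x; rewrite phiper k1.
apply: circle_homeo_lt => //; first by move=> x; rewrite phiper k1.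
(* Injectivity of [phi]: two consecutive points determine the preceding one. *)
move=> x y exy; apply: inj; last by rewrite exy.
have e1 : b x = b y by apply: (@addIr _ j%:~R); rewrite -!aphi exy.
apply: (@act_inj_start _ _ (b x) (u x)); [exact: ch|rewrite e1; exact: ch|].
have gu : g (u x) = g (u y) by rewrite -(gphi x).2 -(gphi y).2 exy.
by rewrite uact e1 /act gu; rewrite -(uact y).
Qed.

Lemma essential_curve_orbits (P : set ((R * R) * (R * R))) :
  (forall s t, 0 < area_form (dg s) (dg t) -> P (g s, g t)) ->
  ~ null_homotopic P c ->
  exists a phi d j, invariant_orbits g dg a phi d j.
Proof.
move=> PP nn; have [a [b [d [ac bc Cab [ch aper bper]]]]] := curve_lift.
have [d0|d0] := eqVneq d 0; last first.
  have [phi [j aP]] := curve_orbits d0 ac bc Cab ch aper bper.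
  by exists a, phi, d, j.
exfalso; apply: nn; apply: (chord_null_homotopic PP ac bc ch).
- by rewrite -[1]add0r aper d0 addr0.
- by rewrite -[1]add0r bper d0 addr0.
by move=> x x01; rewrite -C_id.
Qed.

End Lifts.

(** Reversing the parameter of the curve, not the dynamics, reduces negative degree to positive
    degree. *)
Lemma invariant_orbits_reverse (R : realType) (g dg : R -> R * R) (a phi : R -> R)
    (d j : int) : invariant_orbits g dg a phi d j ->
  invariant_orbits g dg (fun x => a (- x)) (fun x => - phi (- x)) (- d) j.
Proof.
move=> aP.
have per x : a (- (x + 1)) = a (- x) + (- d)%:~R.
  have := inv_periodic aP (- (x + 1)).
  by rewrite (_ : - (x + 1) + 1 = - x) ?mulrNz; [lra|ring].
have phiper x : phi (- (x + 1)) = phi (- x) - 1.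
  have := inv_map_periodic aP (- (x + 1)).
  by rewrite (_ : - (x + 1) + 1 = - x); [lra|ring].
split => //.
- by move=> x; apply: (@continuous_comp _ _ _ (fun x : R => - x) a);
    [exact: opp_continuous|exact: inv_continuous aP _].
- move=> x; apply: cvgN.
  by apply: (@continuous_comp _ _ _ (fun x : R => - x) phi);
    [exact: opp_continuous|exact: inv_map_continuous aP _].
- by rewrite oppr_eq0; exact: inv_degree_neq0 aP.
- by move=> x; rewrite phiper; ring.
- by move=> x y xy; rewrite ltrN2; apply: (inv_map_lt aP); rewrite ltrN2.
- by move=> x; rewrite opprK; exact: inv_chord aP _.
- by move=> x; rewrite !opprK; exact: inv_act aP _.
by move=> x y; rewrite !opprK => e1 e2; apply: oppr_inj; exact: (inv_inj aP).
Qed.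

Theorem theorem2 (R : realType) (gamma : R -> R * R)
    (gamma_closed : smooth_closed_curve gamma)
    (gamma_convex : strictly_convex gamma)
    (gamma_oriented : positively_oriented gamma)
    (gamma_flat : exists t : R, curvature gamma t = 0) :
  ~ has_caustic gamma.
Proof.
move=> [c [[cc cP c01 cinj] not_null inv]].
have gP := curve_oval gamma_closed gamma_convex gamma_oriented.
have itv01 x : 0 <= x <= 1 -> `[0, 1]%classic x by rewrite /= in_itv.
have phaseE := phase_spaceE gamma_closed gamma_convex gamma_oriented.
have inj (s t : R) : 0 <= s < 1 -> 0 <= t < 1 -> c s = c t -> s = t.
  by move=> s01 t01; apply: cinj; rewrite /= in_itv.
have phase x : 0 <= x <= 1 -> exists s t, c x = (gamma s, gamma t) /\
    0 < area_form (derive1 gamma s) (derive1 gamma t).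
  by move=> /itv01 /cP /phaseE.
have billiard_inv x s t : 0 <= x <= 1 -> c x = (gamma s, gamma t) ->
    0 < area_form (derive1 gamma s) (derive1 gamma t) ->
    exists y u, [/\ 0 <= y <= 1, c y = (gamma t, gamma u),
      0 < area_form (derive1 gamma t) (derive1 gamma u) &
      act gamma (derive1 gamma) s t u = 0].
  move=> /itv01 x01 cx st.
  have : (symplectic_billiard gamma @` (c @` `[0, 1]%classic))
      (symplectic_billiard gamma (c x)) by exists (c x) => //; exists x.
  rewrite inv => -[y y01 cy].
  have := cP y y01; rewrite cy cx.
  move=> /(billiardE gamma_closed gamma_convex gamma_oriented st)[u [e h1 h2]].
  by exists y, u; split => //; rewrite cy cx.
have [|a [phi [d [j aP]]]] :=
  essential_curve_orbits gP cc c01 inj phase billiard_inv _ not_null.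
  by move=> s t st; apply/phaseE; exists s, t.
have [t0 flat] := gamma_flat.
have {}flat : area_form (derive1 gamma t0) (derive1n 2 gamma t0) = 0.
  move: flat; rewrite /curvature => /eqP; rewrite mulf_eq0 invr_eq0 expf_eq0 /=.
  by rewrite (gt_eqF (euclidean_norm_gt0 (tangent_neq0 gP t0))) orbF => /eqP.
have := inv_degree_neq0 aP; rewrite neq_lt => /orP[d0|d0]; last first.
  exact: (no_flat_point gP aP d0 flat).
have d0' : (0 < - d)%R by rewrite oppr_gt0.
exact: (no_flat_point gP (invariant_orbits_reverse aP) d0' flat).
Qed.
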